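(* Fix some $n\in\mathbb N_0$ and let $(a,b)=(\mathrm e_n,\infty)$. Let $p_0(x)=1$, $q_0(x)=Q_n(x)$, and suppose that, as $x\to\infty$, $$q_1(x)=Q_n(x)+O\Big(\frac1{L_n(x)^2}\Big),\qquad p_1(x)=1+\begin{cases}o(1),&n=0,\\ O\Big(\dfrac{x^2}{L_n(x)^2}\Big),&n\ge1.\end{cases}$$ Then $\tau_1$ is oscillatory if $$\inf_{\ell>0}\limsup_{x\to\infty}\frac1\ell\int_x^{x+\ell}L_n(t)^2\left(\Delta q(t)+\frac{\delta_n}{4t^2}\Delta p(t)\right)dt<-\frac14$$ and nonoscillatory if $$\sup_{\ell>0}\liminf_{x\to\infty}\frac1\ell\int_x^{x+\ell}L_n(t)^2\left(\Delta q(t)+\frac{\delta_n}{4t^2}\Delta p(t)\right)dt>-\frac14,$$ where $\delta_n=0$ for $n=0$ and $\delta_n=1$ for $n\ge1$.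
   Context: $\tau_j=\frac1r\left(-\frac{d}{dx}p_j\frac{d}{dx}+q_j\right)$, $j=0,1$, are Sturm--Liouville expressions on $(a,b)$ with real-valued coefficients satisfying $p_j^{-1},q_j,r\in L^1_{loc}(a,b)$ and $p_j,r>0$. Standing assumptions: for both $\tau_0$ and $\tau_1$ the endpoint $a\in\mathbb R$ is regular (i.e. $q_j,p_j^{-1},r$ are integrable near $a$) and $b$ is limit point (i.e. $(\tau_j-z)u=0$ has, up to multiples, at most one solution which is in $L^2(r\,dx)$ near $b$). Notation: $\Delta p=\frac1{p_0}-\frac1{p_1}$, $\Delta q=q_1-q_0$. $\tau_1$ is called nonoscillatory if one (equivalently, every) nontrivial solution of $\tau_1u=0$ has finitely many zeros in $(a,b)$, and oscillatory otherwise. Iterated logarithms: $\log_0(x)=x$, $\log_n(x)=\log(\log_{n-1}(x))$, with the convention $\log(x)=\log|x|$ for negative $x$; $\mathrm e_{-1}=-\infty$, $\mathrm e_n=\mathrm e^{\mathrm e_{n-1}}$ (so $\mathrm e_0=0$). $L_n(x)=\frac{1}{\log_{n+1}'(x)}=\prod_{j=0}^n\log_j(x)$ and $Q_n(x)=-\frac14\sum_{j=0}^{n-1}\frac1{L_j(x)^2}$, with $Q_0=0$. $\mathbb N_0=\{0,1,2,\dots\}$. *)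

(* Defs.v *)
From HB Require Import structures.
From mathcomp Require Import all_boot all_order all_algebra.
From mathcomp Require Import complex.
From mathcomp Require Import all_classical all_reals all_analysis.

Set Implicit Arguments.
Unset Strict Implicit.
Unset Printing Implicit Defensive.

Import Order.TTheory GRing.Theory Num.Theory.
Import numFieldNormedType.Exports.

Local Open Scope classical_set_scope.
Local Open Scope ring_scope.
Local Open Scope complex_scope.

(* Required by the notations f = g +o_ +oo h and f = g +O_ +oo h. *)
Canonical pinfty_filter_on (R : numFieldType) : filter_on R :=
  FilterType (pinfty_nbhs R) _.

Section SturmLiouville.
Context {R : realType}.
Implicit Types (a x y : R) (f g p q r : R -> R) (z : R[i]) (u : R -> R[i]).

Local Notation mu := (@lebesgue_measure R).

(* Sturm-Liouville expressions (1/r) (- d/dx p d/dx + q) live on (a, +oo); the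
   values of functions outside of (a, +oo) play no role. *)

(* Here f is locally absolutely continuous on (a, +oo), with derivative g
   almost everywhere: absolutely continuous functions are the indefinite
   integrals of integrable functions. *)
Definition ac_with_derivative a f g : Prop :=
  locally_integrable `]a, +oo[ g /\
  forall x y, a < x -> x <= y -> f y - f x = \int[mu]_(t in `[x, y]) g t.

Definition ac_with_cderivative a (f g : R -> R[i]) : Prop :=
  ac_with_derivative a (fun x => complex.Re (f x)) (fun x => complex.Re (g x)) /\
  ac_with_derivative a (fun x => complex.Im (f x)) (fun x => complex.Im (g x)).

(* u solves (tau - z) u = 0 for tau = (1/r) (- d/dx p d/dx + q): both u and its
   quasi-derivative w = p u' are locally absolutely continuous and the equation
   holds almost everywhere. *)
Definition sl_solution a p q r z u : Prop :=
  exists du w dw : R -> R[i],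
    [/\ ac_with_cderivative a u du,
        ac_with_cderivative a w dw &
        {ae mu, forall x, a < x ->
          w x = (p x)%:C * du x /\
          ((r x)^-1)%:C * (- dw x + (q x)%:C * u x) - z * u x = 0}].

Definition sl_coefficients a p q r : Prop :=
  [/\ locally_integrable `]a, +oo[ (fun x => (p x)^-1),
      locally_integrable `]a, +oo[ q,
      locally_integrable `]a, +oo[ r &
      forall x, a < x -> 0 < p x /\ 0 < r x].

Definition regular_left a p q r : Prop :=
  exists2 c, a < c &
    [/\ mu.-integrable `]a, c] (fun x => ((p x)^-1)%:E),
        mu.-integrable `]a, c] (fun x => (q x)%:E) &
        mu.-integrable `]a, c] (fun x => (r x)%:E)].

Definition L2_near_pinfty a r u : Prop :=
  exists2 c, a < c &
    mu.-integrable `[c, +oo[ (fun x => (Normc.normc (u x) ^+ 2 * r x)%:E).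

Definition limit_point_pinfty a p q r : Prop :=
  forall z u1 u2,
    sl_solution a p q r z u1 -> L2_near_pinfty a r u1 ->
    sl_solution a p q r z u2 -> L2_near_pinfty a r u2 ->
    exists c1 c2 : R[i], (c1 != 0 \/ c2 != 0) /\
      forall x, a < x -> c1 * u1 x + c2 * u2 x = 0.

(* Oscillation concerns the zeros of real-valued solutions: a complex-valued
   solution such as exp(ix) of - u'' = u need not have any. *)
Definition nonoscillatory a p q r : Prop :=
  exists v : R -> R,
    [/\ sl_solution a p q r 0 (fun x => (v x)%:C),
        exists2 x, a < x & v x != 0 &
        finite_set [set x | a < x /\ v x = 0]].

Definition oscillatory a p q r : Prop := ~ nonoscillatory a p q r.

Fixpoint iter_log (n : nat) x : R :=
  if n is m.+1 then ln `|iter_log m x| else x.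

(* The convention e_{-1} = -oo amounts to e_0 = 0. *)
Fixpoint iter_e (n : nat) : R := if n is m.+1 then expR (iter_e m) else 0.

Definition iter_L (n : nat) x : R := \prod_(0 <= j < n.+1) iter_log j x.

Definition iter_Q (n : nat) x : R := - 4^-1 * \sum_(0 <= j < n) (iter_L j x ^+ 2)^-1.

Definition Delta_p (p0 p1 : R -> R) x : R := (p0 x)^-1 - (p1 x)^-1.

Definition Delta_q (q0 q1 : R -> R) x : R := q1 x - q0 x.

Definition delta (n : nat) : R := if n is 0%N then 0 else 1.

Definition average f (l x : R) : R := l^-1 * \int[mu]_(t in `[x, x + l]) f t.

Definition inf_limsup_average f : \bar R :=
  ereal_inf [set limf_esup (fun x => (average f l x)%:E) +oo
            | l in [set l : R | 0 < l]].

Definition sup_liminf_average f : \bar R :=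
  ereal_sup [set limf_einf (fun x => (average f l x)%:E) +oo
            | l in [set l : R | 0 < l]].

End SturmLiouville.

(* Main.v *)
Require Import Defs.
From HB Require Import structures.
From mathcomp Require Import all_boot all_order all_algebra.
From mathcomp Require Import complex.
From mathcomp Require Import all_classical all_reals all_analysis.
From mathcomp Require Import measurable_realfun.
From mathcomp Require Import ring lra.

(** Write L for L_n and let v0 = L_{n-1}' / (2 L_{n-1}), where L_{-1} = 1; this is the
    logarithmic derivative of the solution sqrt(L_{n-1}) of - u'' + Q_n u = 0; thus
    v0' + v0^2 = Q_n, and L' = 2 v0 L + 1.  If - (p1 u')' + q1 u = 0 and u has no
    zeros near infinity, then y = p1 u' / u satisfies the Riccati equation
    y' = q1 - y^2 / p1, and sigma = L (y - v0) satisfies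
<<
      L sigma' = sigma - sigma^2 + L^2 (q1 - Q_n) + Dp (L v0 + sigma)^2
               = sigma - sigma^2 + F + o(1) (1 + sigma^2),
>>
    where Dp = 1 - 1/p1 and F is the function whose averages are taken in the
    theorem.  Indeed x v0 tends to 1/2 if n >= 1 and vanishes if n = 0, so the
    term Dp (L v0)^2 is delta_n L^2 Dp / (4 x^2) up to o(1), and the decay of Dp
    makes the terms with sigma negligible.  Since sigma - sigma^2 is at most 1/4,
    the critical value of F is - 1/4.

    Only averages of F are controlled.  As F is bounded near infinity, there is a
    bounded H whose derivative is the moving average of F minus F
    (moving_average_corrector).  Since H / L tends to 0, passing from sigma to
    sigma + H / L replaces F by its average at the cost of another o(1).

    If the averages stay below - 1/4 - eps, then k = sigma + H / L - 1/2 satisfies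
    L k' <= - (eps / 2 + k^2 / 4).  The primitive log_{n+1} of 1 / L is unbounded, so
    such a k reaches - oo at a finite point (riccati_blow_up): no solution can be
    free of zeros near infinity (perturbed_oscillation).

    If they stay above - 1/4 + eps, then sigma = 1/2 - H / L yields a function v with
    v' + v^2 / p1 <= q1 (perturbed_subsolution).  For a solution u with
    quasi-derivative w = p1 u', the function h = w - v u satisfies
<<
      (u h)' = h^2 / p1 + (q1 - v' - v^2 / p1) u^2 >= 0,
>>
    and this leaves room for at most one zero of u far out
    (riccati_at_most_one_zero).  The solution u is obtained by Picard iteration
    from the regular endpoint (linear_system_solution), with u = 1 and w = 0 there.
    Since u and w never vanish together (linear_system_nonvanishing), its zeros are
    isolated, hence finite in number on compact intervals.

    The coefficients are merely locally integrable, so all of this takes place among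
    absolutely continuous functions, that is, indefinite integrals.  Their chain rule
    (ray_ac_comp), and with it the product and quotient rules, comes from the fact
    that a function is constant if its increments are locally small compared to
    those of a monotone function (relative_derivative0_cst). *)

Set Implicit Arguments.
Unset Strict Implicit.
Unset Printing Implicit Defensive.

Import Order.TTheory GRing.Theory Num.Theory.
Import numFieldNormedType.Exports.

Local Open Scope classical_set_scope.
Local Open Scope ring_scope.

(** * Local-to-global principles on a compact interval *)

Section RealInduction.
Context {R : realType}.
Implicit Types (a b x y z : R).

(** Real induction: the supremum of the points reached from a by Rel is itself
    reached, and can be passed unless it is b. *)
Lemma interval_induction (Rel : R -> R -> Prop) a b : a <= b ->
  (forall x y z, x <= y -> y <= z -> Rel x y -> Rel y z -> Rel x z) ->
  (forall x, a <= x <= b -> exists2 d : R, 0 < d & forall y, a <= y <= b ->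
     `|y - x| < d -> (y <= x -> Rel y x) /\ (x <= y -> Rel x y)) ->
  Rel a b.
Proof.
move=> ab Rtrans Rloc.
pose S := [set x | a <= x <= b /\ Rel a x].
have Sa : S a.
  have aab : a <= a <= b by rewrite lexx.
  split=> //; have [d d0 /(_ a aab)] := Rloc _ aab.
  by rewrite subrr normr0 => /(_ d0)[+ _]; exact.
have supS : has_sup S.
  by split; [exists a | exists b => x [/andP[]]].
set s := sup S.
have sab : a <= s <= b.
  apply/andP; split; first exact: (sup_upper_bound supS).
  by apply: sup_le_ub => //; [exists a|move=> x [/andP[]]].
have [d d0 dP] := Rloc _ sab.
have [x [xab Rax] sx] := sup_adherent d0 supS.
have xs : x <= s by exact: (sup_upper_bound supS).
have Ras : Rel a s.
  have [|Rxs _] := dP x xab.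
    by rewrite ler0_norm ?subr_le0//; move: sx; rewrite -/s; lra.
  by apply: Rtrans Rax (Rxs xs) => //; case/andP: xab.
have := sab; rewrite le_eqVlt => /andP[as_ /predU1P[<-//|sb]].
pose y := Num.min b (s + d / 2).
have sy : s < y by rewrite lt_min sb/=; lra.
have yab : a <= y <= b.
  by rewrite (le_trans as_ (ltW sy))/= ge_min lexx.
have [|_ Rsy] := dP y yab.
  rewrite gtr0_norm ?subr_gt0//.
  have : y <= s + d / 2 by rewrite ge_min lexx orbT.
  lra.
suff : y <= s by rewrite leNgt sy.
have Ray : Rel a y by apply: (Rtrans a s y) => //; [exact: ltW | exact/Rsy/ltW].
exact: (sup_upper_bound supS).
Qed.

(** The hypothesis says that D has derivative 0 with respect to N.  For each e the
    inequality between increments is additive, so it extends from short intervals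
    to [a, b], and e is arbitrary. *)
Lemma relative_derivative0_cst (D N : R -> R) a b : a <= b ->
  (forall x y, a <= x -> x <= y -> N x <= N y) ->
  (forall e, 0 < e -> forall x, a <= x <= b ->
     exists2 d : R, 0 < d & forall y, a <= y <= b ->
       `|y - x| < d -> `|D y - D x| <= e * `|N y - N x|) ->
  D b = D a.
Proof.
move=> ab Nmono Dloc; apply/eqP; rewrite -subr_eq0 -normr_eq0.
have N0 : 0 <= N b - N a by rewrite subr_ge0; exact: Nmono.
suff key e : 0 < e -> `|D b - D a| <= e * (N b - N a).
  rewrite eq_le normr_ge0 andbT; apply/ler_addgt0Pr => e e0; rewrite add0r.
  have e'0 : 0 < e / (N b - N a + 1) by rewrite divr_gt0//; lra.
  apply: (le_trans (key _ e'0)); rewrite mulrAC ler_pdivrMr; last lra.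
  by apply: ler_wpM2l; [exact: ltW|lra].
move=> e0.
apply: (proj2 (_ : a <= a /\ `|D b - D a| <= e * (N b - N a))).
apply: (@interval_induction (fun x y => a <= x /\ `|D y - D x| <= e * (N y - N x))) => //.
  move=> x y z xy yz [ax h1] [_ h2]; split=> //.
  rewrite -(subrKA (D y)) (le_trans (ler_normD _ _))//.
  by move: (lerD h2 h1); rewrite -mulrDr subrKA.
move=> x /[dup] xab /(Dloc e e0)[d d0 dP]; exists d => // y yab yx.
have := dP y yab yx => {}dP; case/andP: xab => ax _; case/andP: yab => ay _.
split=> le; split=> //.
- by rewrite distrC (le_trans dP)// distrC ger0_norm// subr_ge0 Nmono.
- by rewrite (le_trans dP)// ger0_norm// subr_ge0 Nmono.
Qed.

End RealInduction.

(** * Absolutely continuous functions on a half-line *)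

Section Ray.
Context {R : realType}.
Implicit Types (a b x y : R) (f g h : R -> R).
Local Notation mu := (@lebesgue_measure R).

Definition ray_integrable a g : Prop :=
  forall x, a <= x -> mu.-integrable `[a, x] (EFin \o g).

(** Absolute continuity on [a, +oo), with g as derivative.  The derivative is part
    of the data: identities between derivatives can then be checked pointwise, with
    no exceptional null sets. *)
Definition ray_ac a f g : Prop :=
  ray_integrable a g /\
  forall x, a <= x -> f x = f a + \int[mu]_(t in `[a, x]) g t.

(** Continuity on [a, +oo).  Freezing f to the left of a makes this a statement
    about a continuous function on the whole line, without one-sided limits. *)
Definition ray_continuous a f : Prop := continuous (fun x => f (Num.max a x)).

Lemma ray_integrable_sub a g x y : ray_integrable a g -> a <= x -> x <= y ->
  mu.-integrable `[x, y] (EFin \o g).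
Proof.
move=> ig ax xy; apply: integrableS (ig y (le_trans ax xy)) => //.
by apply: subset_itvr; rewrite bnd_simp.
Qed.

Lemma ray_integrable_restrict a c g : ray_integrable a g -> a <= c ->
  ray_integrable c g.
Proof. by move=> ig ac x cx; exact: ray_integrable_sub ig ac cx. Qed.

Lemma ray_acE a f g x y : ray_ac a f g -> a <= x -> x <= y ->
  f y - f x = \int[mu]_(t in `[x, y]) g t.
Proof.
move=> [ig fE] ax xy; rewrite (fE x)// (fE y ((le_trans ax xy))).
rewrite opprD addrACA subrr add0r.
have := @Rintegral_itvB R g (BLeft a) (BRight y) x (ig y (le_trans ax xy)).
rewrite !bnd_simp => /(_ ax xy) ->.
rewrite Rintegral_itv_obnd_cbnd//.
apply: integrableS (ray_integrable_sub ig ax xy) => //.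
by apply: subset_itvr; rewrite bnd_simp.
Qed.

Lemma ray_ac_restrict a c f g : ray_ac a f g -> a <= c -> ray_ac c f g.
Proof.
move=> fg ac; split; first exact: ray_integrable_restrict fg.1 ac.
by move=> x cx; rewrite -(ray_acE fg ac cx) addrC subrK.
Qed.

Lemma ray_ac_primitive a c g : ray_integrable a g ->
  ray_ac a (fun x => c + \int[mu]_(t in `[a, x]) g t) g.
Proof.
move=> ig; split=> // x ax.
by rewrite set_itv1 Rintegral_set1 addr0.
Qed.

Lemma ray_integrableD a g h : ray_integrable a g -> ray_integrable a h ->
  ray_integrable a (fun x => g x + h x).
Proof. by move=> ig ih x ax; exact: (@integrableD _ _ _ mu _ (measurable_itv _) _ _ (ig x ax) (ih x ax)). Qed.

Lemma ray_integrableZ a k g : ray_integrable a g ->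
  ray_integrable a (fun x => k * g x).
Proof. by move=> ig x ax; exact: (@integrableZl _ _ _ mu _ (measurable_itv _) k _ (ig x ax)). Qed.

Lemma ray_integrable_norm a g : ray_integrable a g ->
  ray_integrable a (fun x => `|g x|).
Proof. by move=> ig x ax; exact: (@integrable_norm _ _ _ mu _ _ (ig x ax)). Qed.

Lemma ray_acD a f f' g g' : ray_ac a f f' -> ray_ac a g g' ->
  ray_ac a (fun x => f x + g x) (fun x => f' x + g' x).
Proof.
move=> [if' fE] [ig' gE]; split; first exact: ray_integrableD.
move=> x ax; rewrite RintegralD//; [|exact: if'|exact: ig'].
by rewrite (fE x)// (gE x)// addrACA.
Qed.

Lemma ray_acZ a k f f' : ray_ac a f f' ->
  ray_ac a (fun x => k * f x) (fun x => k * f' x).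
Proof.
move=> [if' fE]; split; first exact: ray_integrableZ.
by move=> x ax; rewrite RintegralZl// ?(fE x)// ?mulrDr//; exact: if'.
Qed.

Lemma ray_integrable_eq a f g : (forall x, a <= x -> f x = g x) ->
  ray_integrable a f -> ray_integrable a g.
Proof.
move=> fg iF x ax; apply: eq_integrable (iF x ax) => // t.
by rewrite inE/= in_itv/= => /andP[ta _]; rewrite fg.
Qed.

Lemma ray_ac_eq a f g f' g' : (forall x, a <= x -> f x = g x) ->
  (forall x, a <= x -> f' x = g' x) -> ray_ac a f f' -> ray_ac a g g'.
Proof.
move=> fg fg' [if' fE]; split=> x ax.
  apply: eq_integrable (if' x ax) => // t; rewrite inE/= in_itv/= => /andP[ta _].
  by rewrite fg'.
rewrite -!fg// fE//; congr (_ + _); apply: eq_Rintegral => t.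
by rewrite inE/= in_itv/= => /andP[ta _]; rewrite fg'.
Qed.

Lemma ray_acB a f f' g g' : ray_ac a f f' -> ray_ac a g g' ->
  ray_ac a (fun x => f x - g x) (fun x => f' x - g' x).
Proof.
move=> ff' gg'; apply: ray_ac_eq (ray_acD ff' (ray_acZ (-1) gg')) => x _;
  by rewrite mulN1r.
Qed.

Lemma ray_ac_cst a k : ray_ac a (fun=> k) (fun=> 0).
Proof.
split=> [x ax|x ax]; last by rewrite Rintegral_cst//= mul0r addr0.
exact: (@integrable0 _ _ _ mu).
Qed.

Lemma ray_ac_le a F G N M x y : ray_ac a F G -> ray_ac a N M ->
  a <= x -> x <= y -> (forall t, x <= t <= y -> G t <= M t) ->
  F y - F x <= N y - N x.
Proof.
move=> FG NM ax xy GM; rewrite (ray_acE FG)// (ray_acE NM)//.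
apply: le_Rintegral => //.
- exact: ray_integrable_sub FG.1 ax xy.
- exact: ray_integrable_sub NM.1 ax xy.
Qed.

(** The order of x and y is left open because this is used at a point and all its
    neighbours at once. *)
Lemma ray_ac_dist a F G N M x y : ray_ac a F G -> ray_ac a N M ->
  a <= x -> a <= y ->
  (forall t, Num.min x y <= t <= Num.max x y -> `|G t| <= M t) ->
  `|F y - F x| <= `|N y - N x|.
Proof.
move=> FG NM.
wlog xy : x y / x <= y.
  move=> W ax ay GM; have [/W|/ltW/W] := leP x y; first exact.
  by rewrite distrC (distrC (N y)) minC maxC => h; exact: h.
move=> ax ay; rewrite min_l// max_r// => GM.
apply: le_trans (ler_norm _); rewrite ler_norml; apply/andP; split.
  rewrite lerNl -mulN1r mulrBr.
  apply: (ray_ac_le (ray_acZ (-1) FG) NM ax xy) => t /GM; rewrite mulN1r.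
  by rewrite ler_norml => /andP[]; rewrite lerNl.
apply: (ray_ac_le FG NM ax xy) => t /GM.
by rewrite ler_norml => /andP[].
Qed.

Lemma ray_continuousP a f : ray_continuous a f <->
  forall x, a <= x -> forall e, 0 < e -> exists2 d : R, 0 < d &
    forall y, a <= y -> `|y - x| < d -> `|f y - f x| < e.
Proof.
split.
  move=> cf x ax e e0; have := cf x; rewrite /continuous_at (max_r ax).
  move=> /cvgrPdist_lt/(_ e e0)[d /= d0 dP].
  exists d => // y ay yx; have := dP y; rewrite /= distrC max_r// => /(_ yx).
  by rewrite distrC.
move=> cf x; apply/cvgrPdist_lt => e e0.
have amax : a <= Num.max a x by rewrite le_max lexx.
have [d d0 dP] := cf _ amax e e0.
exists d => //= y xy; rewrite distrC; apply: dP; first by rewrite le_max lexx.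
apply: le_lt_trans xy; rewrite (distrC x).
rewrite /Num.max; case: ifPn => ay; case: ifPn => ax => //.
- rewrite -leNgt in ax; rewrite !ger0_norm ?subr_ge0//; lra.
- rewrite -leNgt in ay.
  rewrite !ler0_norm ?subr_le0//; lra.
- by rewrite subrr normr0.
Qed.

(** The integral of the integrable function g over a set is small with the measure
    of that set. *)
Lemma ray_ac_continuous a f g : ray_ac a f g -> ray_continuous a f.
Proof.
move=> fg; apply/ray_continuousP => x ax e e0.
pose A := [set` `[a, x + 1]].
have axx : a <= x + 1 by lra.
have iA : mu.-integrable setT (EFin \o (g \_ A)).
  rewrite -restrict_EFin; apply/integrable_restrict => //=.
    exact: measurable_itv.
  by rewrite setTI; exact: fg.1.
have [d [d0 dP]] := integral_normr_continuous iA e0.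
exists (Num.min d 1); first by rewrite lt_min d0/=.
suff key : forall u v, a <= u -> u <= v -> v <= x + 1 -> v - u < d -> `|f v - f u| < e.
  move=> y ay; rewrite lt_min => /andP[yxd yx1]; have [yx|/ltW xy] := leP y x.
    rewrite distrC; apply: key => //; first lra.
    by move: yxd; rewrite ler0_norm ?subr_le0// opprB.
  move: yxd yx1; rewrite ger0_norm ?subr_ge0// => yxd yx1.
  by apply: key => //; lra.
move=> u v au uv vx uvd; rewrite (ray_acE fg)//.
have iuv := ray_integrable_sub fg.1 au uv.
apply: (le_lt_trans (le_normr_Rintegral _ iuv)) => //.
rewrite [ltLHS](_ : _ = \int[mu]_(t in `[u, v]) `|(g \_ A) t|).
  have muuv : (mu `[u, v] < d%:E)%E.
    by rewrite lebesgue_measure_itv/=; case: ifP => _; rewrite ?lte_fin.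
  exact: dP (measurable_itv _) muuv.
apply: eq_Rintegral => t; rewrite inE/= in_itv/= => /andP[ut tv].
rewrite patchE mem_set//= /A/= in_itv/=; lra.
Qed.

Lemma ray_continuous_measurable a f x : ray_continuous a f ->
  measurable_fun `[a, x] f.
Proof.
move=> cf; apply: (@eq_measurable_fun _ _ _ _ _ (fun x => f (Num.max a x))).
  by move=> t; rewrite inE/= in_itv/= => /andP[ta _]; rewrite max_r.
by apply: measurable_funS (continuous_measurable_fun cf) => //.
Qed.

Lemma ray_continuous_bounded a f b : ray_continuous a f ->
  exists2 M : R, 0 < M & forall x, a <= x <= b -> `|f x| <= M.
Proof.
move=> cf; have := @segment_compact R a b.
move=> /(continuous_compact (continuous_subspaceT cf)) /compact_bounded.
move=> [M [_ /(_ (`|M| + 1)) Mf]]; exists (`|M| + 1); first by rewrite ltr_wpDl.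
move=> x /[dup] xab /andP[ax _]; apply: Mf.
  by rewrite (le_lt_trans (ler_norm _))// ltrDl.
by exists x; rewrite ?max_r//= in_itv.
Qed.

Lemma ray_integrableM a f g : ray_continuous a f -> ray_integrable a g ->
  ray_integrable a (fun x => f x * g x).
Proof.
move=> cf ig x ax.
have [M M0 MP] := ray_continuous_bounded x cf.
apply: (@integrableMr _ _ _ mu _ _ f (EFin \o g)) => //.
- exact: ray_continuous_measurable.
- exists M; split; first exact: num_real.
  move=> N MN t; rewrite /= in_itv/= => /MP tM.
  exact: le_trans tM (ltW MN).
- exact: ig.
Qed.

Lemma ray_integrableMr a f g : ray_continuous a f -> ray_integrable a g ->
  ray_integrable a (fun x => g x * f x).
Proof.
by move=> cf ig; under eq_fun do rewrite mulrC; exact: ray_integrableM.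
Qed.

Lemma ray_continuous_cst a k : ray_continuous a (fun=> k).
Proof. by move=> x; exact: cvg_cst. Qed.

End Ray.

(** * Chain, product and quotient rules *)

Section ChainRule.
Context {R : realType}.
Implicit Types (a b x y : R) (f g h : R -> R).
Local Notation mu := (@lebesgue_measure R).

Lemma is_derive_increment (phi : R -> R) x d : is_derive x 1 phi d ->
  forall e, 0 < e -> exists2 dl : R, 0 < dl & forall y, `|y - x| < dl ->
    `|phi y - phi x - d * (y - x)| <= e * `|y - x|.
Proof.
move=> [dphi phiE] e e0; move: dphi => /cvg_ex[l /= hl].
have lE : l = d.
  by rewrite -phiE; apply/esym; exact: cvg_lim hl.
move/cvgrPdist_le : hl => /(_ e e0)[dl /= dl0 dlP].
exists dl => // y yx; have [->|ynx] := eqVneq y x.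
  by rewrite !subrr mulr0 subr0 normr0 mulr0.
have yx0 : y - x != 0 by rewrite subr_eq0.
have := dlP (y - x); rewrite /= sub0r normrN => /(_ yx yx0).
rewrite scaler1 subrK distrC -(ler_pM2r (_ : 0 < `|y - x|)) ?normr_gt0// -normrM.
congr (`|_| <= _); rewrite -lE /GRing.scale/= mulrBl mulrAC mulVf// mul1r; by ring.
Qed.

(** Near x, the increment of phi \o f is phi' (f x) times that of f up to a small
    multiple of the latter, and so is the integral of phi' (f t) f' t because
    phi' \o f is continuous.  Hence the difference of both sides has derivative 0
    with respect to the integral of |f'|. *)
Lemma ray_ac_comp a f f' (phi phi' : R -> R) : ray_ac a f f' ->
  (forall x, a <= x -> is_derive (f x) 1 phi (phi' (f x))) ->
  ray_continuous a (phi' \o f) ->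
  ray_ac a (phi \o f) (fun x => phi' (f x) * f' x).
Proof.
move=> ff' dphi cphi'; have cf := ray_ac_continuous ff'.
have iphif' : ray_integrable a (fun x => phi' (f x) * f' x).
  exact: ray_integrableM cphi' ff'.1.
split=> // b ab.
pose P := fun x => 0 + \int[mu]_(t in `[a, x]) (phi' (f t) * f' t).
pose N := fun x => 0 + \int[mu]_(t in `[a, x]) `|f' t|.
have acP : ray_ac a P _ := ray_ac_primitive 0 iphif'.
have acN : ray_ac a N _ := ray_ac_primitive 0 (ray_integrable_norm ff'.1).
suff : phi (f b) - P b = phi (f a) - P a.
  by rewrite /P set_itv1 Rintegral_set1 addr0 subr0 add0r /= => <-; rewrite subrK.
apply: (@relative_derivative0_cst R (fun x => phi (f x) - P x) N) => //.
  move=> x y ax xy; rewrite -subr_ge0.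
  have := ray_ac_le (ray_ac_cst a 0) acN ax xy; rewrite subrr; apply=> t _.
  exact: normr_ge0.
move=> e e0 x /andP[ax xb]; have e20 : 0 < e / 2 by lra.
have [d1 d10 d1P] := is_derive_increment (dphi x ax) e20.
have [d2 d20 d2P] := (ray_continuousP _ _).1 cf x ax _ d10.
have [d3 d30 d3P] := (ray_continuousP _ _).1 cphi' x ax _ e20.
exists (Num.min d2 d3) => [|y /andP[ay _]]; first by rewrite lt_min d20 d30.
rewrite lt_min => /andP[yd2 yd3].
set c := phi' (f x).
(* c freezes the derivative of phi at f x in both terms *)
have -> : phi (f y) - P y - (phi (f x) - P x) =
    (phi (f y) - phi (f x) - c * (f y - f x)) -
    ((P y - c * f y) - (P x - c * f x)) by ring.
have -> : e * `|N y - N x| = e / 2 * `|N y - N x| + e / 2 * `|N y - N x| by field.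
rewrite (le_trans (ler_normB _ _))// lerD//.
  apply: le_trans (d1P _ (d2P _ ay yd2)) _; rewrite ler_pM2l//.
  by apply: (ray_ac_dist ff' acN).
have -> : e / 2 * `|N y - N x| = `|e / 2 * N y - e / 2 * N x|.
  by rewrite -mulrBr normrM (gtr0_norm e20).
apply: (ray_ac_dist (ray_acB acP (ray_acZ c ff')) (ray_acZ (e / 2) acN)) => //.
move=> t txy; have at_ : a <= t.
  by case/andP : txy => h _; apply: le_trans h; rewrite le_min ax ay.
rewrite -mulrBl normrM ler_wpM2r//; apply/ltW/d3P => //.
apply: le_lt_trans yd3; move: txy; have [xy|yx] := leP x y => /andP[h1 h2].
  by rewrite !ger0_norm ?subr_ge0//; lra.
by rewrite !ler0_norm ?subr_le0//; [lra|exact: ltW].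
Qed.

Lemma ray_ac_id a : ray_ac a id (fun=> 1).
Proof.
split=> [x ax|x ax].
  apply: measurable_bounded_integrable => //=.
    by rewrite lebesgue_measure_itv/=; case: ifP => _; rewrite ?ltry.
  exists 1; split; first exact: num_real.
  by move=> M M1 t _ /=; rewrite normr1 ltW.
rewrite Rintegral_cst//= mul1r lebesgue_measure_itv/= lte_fin.
by case: ltP => /= ax'; rewrite /id; lra.
Qed.

Lemma ray_ac_derive a f f' : (forall x, a <= x -> is_derive x 1 f (f' x)) ->
  ray_continuous a f' -> ray_ac a f f'.
Proof.
move=> df cf'; have := ray_ac_comp (ray_ac_id a) df cf'.
by apply: ray_ac_eq => // x _; rewrite mulr1.
Qed.

(** Polarization reduces products to squares, hence to the chain rule. *)
Lemma ray_acM a f f' g g' : ray_ac a f f' -> ray_ac a g g' ->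
  ray_ac a (fun x => f x * g x) (fun x => f' x * g x + f x * g' x).
Proof.
have sq h h' : ray_ac a h h' -> ray_ac a (fun x => h x ^+ 2) (fun x => 2 * h x * h' x).
  move=> hh'; have ch := ray_ac_continuous hh'.
  apply: (@ray_ac_comp a h h' (fun x => x ^+ 2) (fun x => 2 * x)) => //.
    by move=> x ax; apply: is_derive_eq; rewrite /GRing.scale/=; ring.
  by move=> x; apply: cvgM (ch x); exact: cvg_cst.
move=> ff' gg'.
have := ray_acZ 2^-1 (ray_acB (ray_acB (sq _ _ (ray_acD ff' gg')) (sq _ _ ff')) (sq _ _ gg')).
by apply: ray_ac_eq => x _; field.
Qed.

Lemma ray_acV a f f' : ray_ac a f f' -> (forall x, a <= x -> f x != 0) ->
  ray_ac a (fun x => (f x)^-1) (fun x => - f' x / f x ^+ 2).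
Proof.
move=> ff' f0; have cf := ray_ac_continuous ff'.
apply: ray_ac_eq (@ray_ac_comp a f f' (fun x => x^-1) (fun x => - x ^- 2) ff' _ _).
- by [].
- by move=> x ax; rewrite !mulNr mulrC.
- move=> x ax; have := @is_deriveV R id (f x) 1 1 (f0 x ax) _.
  by rewrite /GRing.scale/= mulr1; apply; exact: is_derive_id.
- move=> x; apply: cvgN; apply: cvgV.
    by rewrite expf_neq0// f0// le_max lexx.
  rewrite expr2; under eq_fun do rewrite expr2.
  by apply: cvgM; exact: cf.
Qed.

Lemma ray_ac_expR a f f' : ray_ac a f f' ->
  ray_ac a (fun x => expR (f x)) (fun x => expR (f x) * f' x).
Proof.
move=> ff'; apply: (ray_ac_comp ff') => x.
apply: (@continuous_comp _ _ _ (fun x => f (Num.max a x)) expR).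
  exact: (ray_ac_continuous ff').
exact: continuous_expR.
Qed.

End ChainRule.

(** * Linear systems with integrable coefficients *)

Section LinearSystem.
Context {R : realType}.
Implicit Types (a b x y : R) (f g h : R -> R).
Local Notation mu := (@lebesgue_measure R).

Lemma ray_dominated_convergence a (f_ : nat -> R -> R) f g :
  (forall k, ray_integrable a (f_ k)) -> ray_integrable a g ->
  (forall k x, a <= x -> `|f_ k x| <= g x) ->
  (forall x, a <= x -> f_ ^~ x @ \oo --> f x) ->
  ray_integrable a f /\
  forall x, a <= x -> \int[mu]_(t in `[a, x]) f_ k t @[k --> \oo] -->
    \int[mu]_(t in `[a, x]) f t.
Proof.
move=> if_ ig fg f_f.
suff H x : a <= x -> mu.-integrable `[a, x] (EFin \o f) /\
    \int[mu]_(t in `[a, x]) f_ k t @[k --> \oo] --> \int[mu]_(t in `[a, x]) f t.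
  by split=> x /H[].
move=> ax.
have cf t : `[a, x]%classic t -> (EFin \o f_ k) t @[k --> \oo] --> (EFin \o f) t.
  rewrite /= in_itv/= => /andP[ta _].
  by apply/fine_cvgP; split; [exact: nearW | exact: f_f].
have [] := @dominated_convergence _ _ R mu `[a, x]%classic (measurable_itv _)
   (fun k => EFin \o f_ k) (EFin \o f) (EFin \o g).
- by move=> k; exact: measurable_int (if_ k x ax).
- apply: (emeasurable_fun_cvg (fun k => EFin \o f_ k)) cf => k.
  exact: measurable_int (if_ k x ax).
- by apply: aeW => t; exact: cf.
- exact: ig.
- apply: aeW => t k /=; rewrite in_itv/= => /andP[ta _].
  by rewrite lee_fin fg.
move=> if_x _ cvgx; split=> //.
have /fineK fK := @integrable_fin_num _ _ _ mu _ (measurable_itv _) _ if_x.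
by apply: fine_cvg; rewrite fK.
Qed.

Lemma cvg_of_geometric_increments (s : nat -> R) (C : R) :
  (forall k, `|s k.+1 - s k| <= C / 2 ^+ k) -> s 0%N = 0 ->
  exists2 l : R, s @ \oo --> l & forall k, `|s k| <= 2 * C.
Proof.
move=> sC s0.
have C0 : 0 <= C by have := sC 0%N; rewrite expr0 divr1; exact: le_trans.
have sE k : s k = series (telescope s) k.
  by rewrite {1}(eq_sum_telescope s k) s0 add0r.
have cs : cvgn (series (telescope s)).
  apply: normed_cvg.
  apply: (series_le_cvg (v_ := geometric C 2^-1)) => [k|k|k|].
  - exact: normr_ge0.
  - by rewrite /geometric/= mulr_ge0// exprn_ge0// invr_ge0.
  - by rewrite /telescope/= exprVn; exact: sC.
  - by apply: is_cvg_geometric_series; rewrite ger0_norm ?invr_ge0//; lra.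
have sTE : series (telescope s) = s by apply: funext => k; rewrite -sE.
rewrite sTE in cs; exists (limn s) => //.
have bound k : `|s k| <= 2 * C - 2 * C / 2 ^+ k.
  elim: k => [|k IH]; first by rewrite s0 normr0 expr0 divr1 subrr.
  rewrite -(subrK (s k) (s k.+1)) (le_trans (ler_normD _ _))//.
  apply: (le_trans (lerD (sC k) IH)); rewrite exprS le_eqVlt; apply/orP; left.
  by apply/eqP; field; rewrite expf_neq0.
by move=> k; apply: (le_trans (bound k)); rewrite gerBl divr_ge0// ?mulr_ge0// exprn_ge0.
Qed.

Variables (a u0 w0 : R) (al be : R -> R).
Hypotheses (ial : ray_integrable a al) (ibe : ray_integrable a be).

(** The iteration starts from 0 rather than from the initial values, so that its
    first increment is constant and is bounded by the same geometric law as the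
    others. *)
Fixpoint picard (k : nat) : (R -> R) * (R -> R) :=
  if k is k'.+1 then
    (fun x => u0 + \int[mu]_(t in `[a, x]) (al t * (picard k').2 t),
     fun x => w0 + \int[mu]_(t in `[a, x]) (be t * (picard k').1 t))
  else (fun=> 0, fun=> 0).

Lemma ray_continuous_picard k :
  ray_continuous a (picard k).1 /\ ray_continuous a (picard k).2.
Proof.
elim: k => [|k [cu cw]] /=; first by split; exact: ray_continuous_cst.
split; apply: ray_ac_continuous; apply: ray_ac_primitive;
  exact: ray_integrableMr.
Qed.

Let m x := `|al x| + `|be x|.
Let M x := 0 + \int[mu]_(t in `[a, x]) m t.
Let E x := expR (2 * M x).
Let K := `|u0| + `|w0|.

Let im : ray_integrable a m.
Proof. by apply: ray_integrableD; exact: ray_integrable_norm. Qed.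

Let acE : ray_ac a E (fun x => E x * (2 * m x)).
Proof. by apply: ray_ac_expR; apply: ray_acZ; exact: ray_ac_primitive. Qed.

Let E_ge1 x : 1 <= E x.
Proof.
rewrite -expR0 ler_expR mulr_ge0// /M add0r Rintegral_ge0// => t _.
by rewrite /m addr_ge0.
Qed.

Lemma ray_ac_picardS k : ray_ac a (picard k.+1).1 (fun x => al x * (picard k).2 x) /\
  ray_ac a (picard k.+1).2 (fun x => be x * (picard k).1 x).
Proof.
have [cu cw] := ray_continuous_picard k.
by split; apply: ray_ac_primitive; exact: ray_integrableMr.
Qed.

(** With E = exp (2 M) and M' = m, the integral of m E is at most E / 2: the weight
    makes the iteration a contraction by 1/2 on the whole half-line at once. *)
Lemma picard_increment k x : a <= x ->
  `|(picard k.+1).1 x - (picard k).1 x| <= K / 2 ^+ k * E x /\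
  `|(picard k.+1).2 x - (picard k).2 x| <= K / 2 ^+ k * E x.
Proof.
have K0 : 0 <= K by rewrite addr_ge0.
elim: k x => [|k IH] x ax.
  rewrite /= !subr0 expr0 divr1.
  under eq_Rintegral do rewrite mulr0.
  under [in X in _ /\ X]eq_Rintegral do rewrite mulr0.
  rewrite !Rintegral_cst//= !mul0r !addr0.
  have KE : K <= K * E x by rewrite ler_peMr.
  by split; apply: (le_trans _ KE); rewrite /K ?lerDl ?lerDr.
have step F F' : ray_ac a F F' -> F a = 0 ->
    (forall t, a <= t -> `|F' t| <= m t * (K / 2 ^+ k * E t)) ->
    `|F x| <= K / 2 ^+ k.+1 * E x.
  move=> acF Fa F'm.
  have := ray_ac_dist acF (ray_acZ (K / 2 ^+ k.+1) acE) ax (lexx a).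
  rewrite Fa sub0r normrN min_r// max_l// => /(_ _)/le_trans; apply.
    move=> t /andP[ta _]; apply: (le_trans (F'm t ta)); rewrite exprS.
    by rewrite le_eqVlt; apply/orP; left; apply/eqP; field; rewrite expf_neq0.
  have Kk : 0 <= K / 2 ^+ k.+1 by rewrite divr_ge0// exprn_ge0.
  have Ea : E a = 1 by rewrite /E /M set_itv1 Rintegral_set1 addr0 mulr0 expR0.
  rewrite Ea mulr1 distrC -{2}[K / _]mulr1 -mulrBr normrM !ger0_norm//; last by rewrite subr_ge0.
  by rewrite ler_wpM2l// gerBl.
have [acu acw] := ray_ac_picardS k; have [acu1 acw1] := ray_ac_picardS k.+1.
split.
  apply: (step _ _ (ray_acB acu1 acu)).
    by rewrite /= set_itv1 !Rintegral_set1 subrr.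
  move=> t ta; rewrite -mulrBr normrM ler_pM//; last by case: (IH t ta).
  by rewrite /m lerDl.
apply: (step _ _ (ray_acB acw1 acw)).
  by rewrite /= set_itv1 !Rintegral_set1 subrr.
move=> t ta; rewrite -mulrBr normrM ler_pM//; last by case: (IH t ta).
by rewrite /m lerDr.
Qed.

(** The Picard iterates converge geometrically with respect to the weight E, locally
    uniformly on the half-line; dominated convergence then passes to the limit in
    the integral equations. *)
Lemma linear_system_solution : exists u w : R -> R,
  [/\ ray_ac a u (fun x => al x * w x), ray_ac a w (fun x => be x * u x),
      u a = u0 & w a = w0].
Proof.
pose pu k x := (picard k).1 x; pose pw k x := (picard k).2 x.
have /choice[u uP] x : exists l : R, a <= x ->
    pu ^~ x @ \oo --> l /\ forall k, `|pu k x| <= 2 * (K * E x).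
  have [ax|xa] := leP a x; last by exists 0.
  have [k|//|l sl bl] := @cvg_of_geometric_increments (pu ^~ x) (K * E x).
    by rewrite mulrAC; case: (picard_increment k ax).
  by exists l.
have /choice[w wP] x : exists l : R, a <= x ->
    pw ^~ x @ \oo --> l /\ forall k, `|pw k x| <= 2 * (K * E x).
  have [ax|xa] := leP a x; last by exists 0.
  have [k|//|l sl bl] := @cvg_of_geometric_increments (pw ^~ x) (K * E x).
    by rewrite mulrAC; case: (picard_increment k ax).
  by exists l.
have cE : ray_continuous a E := ray_ac_continuous acE.
have cKE : ray_continuous a (fun x => 2 * (K * E x)).
  by move=> x; do 2 (apply: cvgM; first exact: cvg_cst); exact: cE.
have lim_step (g : R -> R) (f_ : nat -> R -> R) f c (F_ : nat -> R -> R) F :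
    ray_integrable a g ->
    (forall k, ray_continuous a (f_ k)) ->
    (forall k x, F_ k.+1 x = c + \int[mu]_(t in `[a, x]) (g t * f_ k t)) ->
    (forall x, a <= x -> f_ ^~ x @ \oo --> f x /\ forall k, `|f_ k x| <= 2 * (K * E x)) ->
    (forall x, a <= x -> F_ ^~ x @ \oo --> F x) ->
    ray_ac a F (fun x => g x * f x) /\ F a = c.
  move=> ig cf_ FE f_f F_F.
  have [] := @ray_dominated_convergence a (fun k x => g x * f_ k x)
     (fun x => g x * f x) (fun x => `|g x| * (2 * (K * E x))).
  - by move=> k; exact: ray_integrableMr.
  - by apply: ray_integrableMr => //; exact: ray_integrable_norm.
  - by move=> k x ax; rewrite normrM ler_wpM2l//; case: (f_f x ax).
  - by move=> x ax; apply: cvgM; [exact: cvg_cst | case: (f_f x ax)].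
  move=> igf lim_gf.
  have FxE x : a <= x -> F x = c + \int[mu]_(t in `[a, x]) (g t * f t).
    move=> ax; have h1 : F_ k.+1 x @[k --> \oo] --> F x.
      by have := F_F x ax; rewrite -cvg_shiftS.
    have h2 : F_ k.+1 x @[k --> \oo] --> c + \int[mu]_(t in `[a, x]) (g t * f t).
      under eq_fun do rewrite FE.
      by apply: cvgD; [exact: cvg_cst | exact: lim_gf].
    by rewrite -(cvg_lim _ h1)// -(cvg_lim _ h2).
  have Fa : F a = c by rewrite FxE// set_itv1 Rintegral_set1 addr0.
  by split=> //; split=> // x ax; rewrite Fa; exact: FxE.
have [acu ua] : ray_ac a u (fun x => al x * w x) /\ u a = u0.
  apply: (lim_step _ pw _ _ pu) => //.
  - by move=> k; case: (ray_continuous_picard k).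
  - by move=> x /uP[].
have [acw wa] : ray_ac a w (fun x => be x * u x) /\ w a = w0.
  apply: (lim_step _ pu _ _ pw) => //.
  - by move=> k; case: (ray_continuous_picard k).
  - by move=> x /wP[].
by exists u, w.
Qed.

End LinearSystem.

Section Uniqueness.
Context {R : realType}.
Local Notation mu := (@lebesgue_measure R).
Variables (a : R) (al be u w : R -> R).
Hypotheses (ial : ray_integrable a al) (ibe : ray_integrable a be).
Hypotheses (acu : ray_ac a u (fun x => al x * w x))
  (acw : ray_ac a w (fun x => be x * u x)).

(** Since 2 u w (al + be) >= - (u^2 + w^2) (|al| + |be|), the product of u^2 + w^2
    with exp M, where M' = |al| + |be|, is nondecreasing. *)
Lemma linear_system_nonvanishing b : a <= b ->
  u a ^+ 2 + w a ^+ 2 != 0 -> u b ^+ 2 + w b ^+ 2 != 0.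
Proof.
move=> ab; apply: contra_neq => ub0.
pose m x := `|al x| + `|be x|.
pose M x := 0 + \int[mu]_(t in `[a, x]) m t.
have acM : ray_ac a M m.
  by apply: ray_ac_primitive; apply: ray_integrableD; exact: ray_integrable_norm.
have acE := ray_acM (ray_acD (ray_acM acu acu) (ray_acM acw acw)) (ray_ac_expR acM).
have := ray_ac_le (ray_ac_cst a 0) acE (lexx a) ab.
rewrite subrr -!expr2 ub0 mul0r sub0r oppr_ge0 => le0.
apply/eqP; rewrite eq_le addr_ge0 ?sqr_ge0// andbT.
rewrite -(pmulr_lle0 _ (expR_gt0 (M a))); apply: le0 => t _.
set e := expR _; rewrite [leRHS](_ : _ =
  e * (2 * (u t * w t) * (al t + be t) + (u t ^+ 2 + w t ^+ 2) * m t)); last by ring.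
rewrite mulr_ge0 ?expR_ge0//.
have uw : `|2 * (u t * w t)| <= u t ^+ 2 + w t ^+ 2.
  have h1 := sqr_ge0 (u t + w t); have h2 := sqr_ge0 (u t - w t).
  by rewrite ler_norml; apply/andP; split; nra.
have am : `|al t + be t| <= m t by exact: ler_normD.
have : `|2 * (u t * w t) * (al t + be t)| <= (u t ^+ 2 + w t ^+ 2) * m t.
  by rewrite normrM ler_pM.
rewrite ler_norml => /andP[+ _]; lra.
Qed.

End Uniqueness.

(** * Zeros of solutions and Riccati subsolutions *)

Section Zeros.
Context {R : realType}.
Implicit Types (a b c x y : R) (f g h : R -> R).
Local Notation mu := (@lebesgue_measure R).

(** An integrable function that is positive on an interval of positive length cannot
    have integral 0, since it would vanish almost everywhere. *)
Lemma ray_ac_lt a f g x y : ray_ac a f g -> a <= x -> x < y ->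
  (forall t, x < t < y -> 0 < g t) -> f x < f y.
Proof.
move=> fg ax xy g0; rewrite -subr_gt0 (ray_acE fg ax (ltW xy)).
have ixy := ray_integrable_sub fg.1 ax (ltW xy).
have ioo : mu.-integrable `]x, y[ (EFin \o g).
  by apply: integrableS ixy => //; apply: subset_itv; rewrite bnd_simp.
have -> : \int[mu]_(t in `[x, y]) g t = \int[mu]_(t in `]x, y[) g t.
  rewrite -Rintegral_itv_obnd_cbnd; last first.
    by apply: integrableS ixy => //; apply: subset_itv; rewrite bnd_simp.
  by rewrite -Rintegral_itv_bndo_bndc.
have goo t : `]x, y[%classic t -> 0 < g t by rewrite /= in_itv/=; exact: g0.
have : 0 <= \int[mu]_(t in `]x, y[) g t.
  by apply: Rintegral_ge0 => t /goo/ltW.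
rewrite le_eqVlt => /predU1P[/esym int0|//]; exfalso.
have := @ae_eq_integral_abs _ _ R mu _ (measurable_itv `]x, y[) (EFin \o g)
  (measurable_int mu ioo).
move=> [+ _]; case.
  have fin := @integrable_fin_num _ _ _ mu _ (measurable_itv _) _ ioo.
  rewrite -[RHS](_ : (\int[mu]_(t in `]x, y[) g t)%:E = 0%E); last by rewrite int0.
  rewrite /Rintegral fineK//; apply: eq_integral => t; rewrite inE => /goo gt.
  by rewrite gee0_abs// lee_fin ltW.
move=> N [mN N0 subN].
have : (mu `]x, y[ <= mu N)%E.
  apply: le_measure; rewrite ?inE//; apply: subset_trans subN => t txy /=.
  by move=> /(_ txy)/eqP; rewrite eqe gt_eqF// goo.
rewrite N0 lebesgue_measure_itv/= lte_fin xy -EFinD lee_fin.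
by rewrite leNgt subr_gt0 xy.
Qed.

Variables (a : R) (al be u w : R -> R).
Hypotheses (ial : ray_integrable a al) (ibe : ray_integrable a be).
Hypotheses (acu : ray_ac a u (fun x => al x * w x))
  (acw : ray_ac a w (fun x => be x * u x)).
Hypothesis al_gt0 : forall t, a < t -> 0 < al t.
Hypothesis ua_neq0 : u a != 0.

Lemma zero_derivative_neq0 x : a <= x -> u x = 0 -> w x != 0.
Proof.
move=> ax ux0; have := linear_system_nonvanishing ial ibe acu acw ax.
rewrite ux0 expr0n/= add0r expf_eq0/=; apply.
by rewrite gt_eqF// ltr_pwDl ?sqr_ge0// exprn_even_gt0.
Qed.

(** At a zero of u, the function w is nonzero and so keeps its sign nearby, where u
    is therefore strictly monotone. *)
Lemma zero_isolated x : a <= x -> exists2 d : R, 0 < d &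
  forall y, a <= y -> `|y - x| < d -> u y = 0 -> y = x.
Proof.
move=> ax; have [ux0|ux0] := eqVneq (u x) 0; last first.
  have nux : 0 < `|u x| by rewrite normr_gt0.
  have [d d0 dP] := (ray_continuousP _ _).1 (ray_ac_continuous acu) x ax _ nux.
  exists d => // y ay yx uy0; have := dP y ay yx.
  by rewrite uy0 sub0r normrN ltxx.
have nwx : 0 < `|w x| by rewrite normr_gt0 zero_derivative_neq0.
have [d d0 dP] := (ray_continuousP _ _).1 (ray_ac_continuous acw) x ax _ nwx.
have wsgn t : a <= t -> `|t - x| < d -> 0 < w x * w t.
  move=> at_ /(dP t at_); have [wx|wx|wx] := ltgtP (w x) 0.
  - by rewrite ltr_norml ltr0_norm// => /andP[_ ?]; rewrite nmulr_rgt0//; lra.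
  - by rewrite ltr_norml gtr0_norm// => /andP[? _]; rewrite pmulr_rgt0//; lra.
  - by move: nwx; rewrite wx normr0 ltxx.
have acwu := ray_acZ (w x) acu.
have mono y z : a <= y -> y < z -> `|y - x| < d -> `|z - x| < d ->
    w x * u y < w x * u z.
  move=> ay yz yx zx; apply: (ray_ac_lt acwu ay yz) => t /andP[yt tz].
  rewrite mulrCA mulr_gt0//; first by apply: al_gt0; exact: le_lt_trans yt.
  apply: wsgn; first by rewrite (le_trans ay)// ltW.
  by move: yx zx; rewrite !ltr_norml => /andP[? ?] /andP[? ?]; apply/andP; split; lra.
exists d => // y ay yx uy0; apply/eqP; rewrite eq_le !leNgt.
have xx : `|x - x| < d by rewrite subrr normr0.
apply/andP; split; apply/negP => lt.
  by have := mono _ _ ax lt xx yx; rewrite ux0 uy0 ltxx.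
by have := mono _ _ ay lt yx xx; rewrite ux0 uy0 ltxx.
Qed.

Lemma finite_zeros_segment b : a <= b ->
  finite_set [set x | a <= x <= b /\ u x = 0].
Proof.
move=> ab; apply: (@interval_induction R
  (fun y z => finite_set [set x | y <= x <= z /\ u x = 0])) => //.
  move=> x y z xy yz fxy fyz.
  apply: sub_finite_set (_ : finite_set (_ `|` _)); last by rewrite finite_setU; split; [exact: fxy|exact: fyz].
  move=> t [/andP[xt tz] ut]; have [ty|yt] := leP t y; first by left; rewrite /= xt ty.
  by right; rewrite /= (ltW yt) tz.
move=> x /andP[ax _]; have [d d0 dP] := zero_isolated ax.
exists d => // y /andP[ay _] yx.
split=> le; apply: sub_finite_set (finite_set1 x) => t [/andP[h1 h2] ut];
  apply: dP => //; try lra.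
- by move: yx; rewrite !ler0_norm ?subr_le0//; lra.
- by move: yx; rewrite !ger0_norm ?subr_ge0//; lra.
Qed.

(** The nondecreasing function u h, with h = w - v u, vanishes at the zeros of u.  At
    the first of two zeros h = w is nonzero, so u h increases strictly just
    after it and cannot return to 0. *)
Lemma riccati_at_most_one_zero c v v' : a < c -> ray_ac c v v' ->
  (forall t, c <= t -> v' t + al t * v t ^+ 2 <= be t) ->
  forall x y, c <= x -> x < y -> u x = 0 -> u y != 0.
Proof.
move=> ac acv ric x y cx xy ux0; apply/negP => /eqP uy0.
have acu' := ray_ac_restrict acu (ltW ac).
have acw' := ray_ac_restrict acw (ltW ac).
pose h t := w t - v t * u t.
have ach : ray_ac c h _ := ray_acB acw' (ray_acM acv acu').
have acuh : ray_ac c (fun t => u t * h t) (fun t => al t * w t * h t +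
    u t * (be t * u t - (v' t * u t + v t * (al t * w t)))) := ray_acM acu' ach.
have hx : h x = w x by rewrite /h ux0 mulr0 subr0.
have ax : a <= x by lra.
have nhx : 0 < `|h x| by rewrite hx normr_gt0 zero_derivative_neq0.
have [d d0 dP] := (ray_continuousP _ _).1 (ray_ac_continuous ach) x cx _ nhx.
(* the derivative of u h, completed to a sum of nonnegative terms *)
have G'E t : al t * w t * h t +
    u t * (be t * u t - (v' t * u t + v t * (al t * w t))) =
  al t * h t ^+ 2 + (be t - (v' t + al t * v t ^+ 2)) * u t ^+ 2.
  by rewrite /h; ring.
(* up to z the function h keeps its sign *)
pose z := Num.min y (x + d / 2).
have xz : x < z by rewrite lt_min xy; lra.
have zy : z <= y by rewrite ge_min lexx.
have zd : z <= x + d / 2 by rewrite ge_min lexx orbT.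
have uhz : u x * h x < u z * h z.
  apply: (ray_ac_lt acuh cx xz) => t /andP[xt tz].
  have ct : c <= t by lra.
  have alt : 0 < al t by apply: al_gt0; lra.
  have ht : h t != 0.
    apply/negP => /eqP ht.
    suff : `|t - x| < d by move/(dP t ct); rewrite ht sub0r normrN ltxx.
    by rewrite gtr0_norm ?subr_gt0//; lra.
  rewrite G'E ltr_pwDl//.
    by rewrite mulr_gt0// exprn_even_gt0.
  by rewrite mulr_ge0 ?sqr_ge0// subr_ge0 ric.
have cz : c <= z by lra.
have : u z * h z <= u y * h y.
  rewrite -subr_ge0.
  have := ray_ac_le (ray_ac_cst c 0) acuh cz zy; rewrite subrr; apply => t /andP[zt ty].
  have ct : c <= t by lra.
  have alt : 0 < al t by apply: al_gt0; lra.
  by rewrite G'E; apply: addr_ge0; apply: mulr_ge0; rewrite ?sqr_ge0 ?(ltW alt) ?subr_ge0 ?ric.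
move: uhz; rewrite ux0 uy0 !mul0r; lra.
Qed.

Lemma riccati_finite_zeros c v v' : a < c -> ray_ac c v v' ->
  (forall t, c <= t -> v' t + al t * v t ^+ 2 <= be t) ->
  finite_set [set x | a < x /\ u x = 0].
Proof.
move=> ac acv ric.
have one := riccati_at_most_one_zero ac acv ric.
have [[z [cz uz0]]|nz] := pselect (exists z, c <= z /\ u z = 0).
  have az : a <= z by lra.
  apply: sub_finite_set (finite_zeros_segment az) => x [/ltW ax ux0].
  split=> //; rewrite ax/= leNgt; apply/negP => zx.
  by have := one _ _ cz zx uz0; rewrite ux0 eqxx.
apply: sub_finite_set (finite_zeros_segment (ltW ac)) => x [/ltW ax ux0].
split=> //; rewrite ax/= leNgt; apply/negP => cx.
by apply: nz; exists x; split=> //; exact: ltW.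
Qed.

End Zeros.

(** * Blow-up of Riccati inequalities and correctors for moving averages *)

Section RiccatiBlowUp.
Context {R : realType}.
Implicit Types (a b c x y : R) (f g h : R -> R).

(** The constant eta drives k below - 1; from there on 1 / k is negative, yet
    grows at least as fast as theta La, which is unbounded. *)
Lemma riccati_blow_up c (L La k k' : R -> R) (eta theta : R) :
  0 < eta -> 0 < theta ->
  (forall t, c <= t -> 0 < L t) ->
  ray_ac c La (fun t => (L t)^-1) -> La x @[x --> +oo] --> +oo ->
  ray_ac c k k' ->
  (forall t, c <= t -> k' t <= - ((eta + theta * k t ^+ 2) / L t)) -> False.
Proof.
move=> eta0 theta0 L0 acLa Laoo ack kL.
have LaP (A : R) c' : c <= c' -> exists2 d, c' <= d & forall x, d <= x -> A <= La x.
  move=> cc'; have /cvgryPge/(_ A)[B [_ BP]] := Laoo.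
  exists (Num.max c' (B + 1)) => [|x]; first by rewrite le_max lexx.
  by rewrite ge_max => /andP[_ Bx]; apply: BP => /=; lra.
(* beyond d the linear decay has brought k below - 1 *)
have [d cd dP] := LaP (La c + (k c + 1) / eta) c (lexx _).
have k_lt0 x : d <= x -> k x <= - 1.
  move=> dx; have cx : c <= x := le_trans cd dx.
  have := ray_ac_le ack (ray_acZ (- eta) acLa) (lexx c) cx.
  have h t : c <= t <= x -> k' t <= - eta * (L t)^-1.
    move=> /andP[ct _]; apply: le_trans (kL t ct) _.
    rewrite mulNr lerN2 ler_pM2r ?invr_gt0 ?L0// lerDl mulr_ge0 ?sqr_ge0//.
    exact: ltW.
  move=> /(_ h); have := dP x dx; rewrite -(ler_pM2l eta0) mulrDr.
  rewrite (mulrC eta (_ / _)) divfK ?gt_eqF//; lra.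
have ack' := ray_ac_restrict ack cd.
have acLa' := ray_ac_restrict acLa cd.
have kn0 x : d <= x -> k x != 0 by move=> /k_lt0 kx; apply/negP => /eqP k0; lra.
have ackV := ray_acV ack' kn0.
(* at e the lower bound for 1 / k has become nonnegative *)
have [e de eP] := LaP (La d - (k d)^-1 / theta) d cd.
have := ray_ac_le (ray_acZ theta acLa') ackV (lexx d) de.
have h t : d <= t <= e -> theta * (L t)^-1 <= - k' t / k t ^+ 2.
  move=> /andP[dt _]; have ct : c <= t by lra.
  have k20 : 0 < k t ^+ 2 by rewrite exprn_even_gt0//= kn0.
  rewrite ler_pdivlMr// lerNr; apply: le_trans (kL t ct) _.
  rewrite lerN2 mulrAC ler_pM2r ?invr_gt0 ?L0//; lra.
move=> /(_ h).
have := eP e (lexx e); rewrite -(ler_pM2l theta0) mulrBr.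
rewrite (mulrC theta (_ / _)) divfK ?gt_eqF//.
have : (k e)^-1 < 0 by rewrite invr_lt0; have := k_lt0 e de; lra.
lra.
Qed.

End RiccatiBlowUp.

Section MovingAverage.
Context {R : realType}.
Local Notation mu := (@lebesgue_measure R).
Variables (c l M : R) (F : R -> R).
Hypotheses (l_gt0 : 0 < l) (iF : ray_integrable c F)
  (FM : forall t, c <= t -> `|F t| <= M).

(** With Phi a primitive of F, H is the moving average of Phi minus Phi.  On a window
    of length l the function Phi varies by at most M l, which bounds H. *)
Lemma moving_average_corrector : exists H : R -> R,
  ray_ac c H (fun t => average F l t - F t) /\
  forall t, c <= t -> `|H t| <= M * l.
Proof.
pose Phi x := 0 + \int[mu]_(t in `[c, x]) F t.
have acPhi : ray_ac c Phi F := ray_ac_primitive 0 iF.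
have cPhi := ray_ac_continuous acPhi.
pose Phi_ x := Phi (Num.max c x).
have iPhi_ : ray_integrable c Phi_.
  move=> x cx; apply: continuous_compact_integrable; first exact: segment_compact.
  exact: continuous_subspaceT.
pose Psi x := 0 + \int[mu]_(t in `[c, x]) Phi_ t.
have acPsi : ray_ac c Psi Phi_ := ray_ac_primitive 0 iPhi_.
have dPsi x : c < x -> is_derive x 1 Psi (Phi_ x).
  move=> cx; have x1 : x < x + 1 by lra.
  have [] := @continuous_FTC1_closed R Phi_ c x (x + 1) x1 (iPhi_ _ _) cx (cPhi x).
    by lra.
  move=> der derE; rewrite /Psi (_ : (fun x => _) = fun x => \int[mu]_(t in `[c, x]) Phi_ t); last first.
    by apply: funext => y; rewrite add0r.
  by rewrite -derE derive1E; exact: derivableP.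
have acPsil : ray_ac c (fun x => Psi (x + l)) (fun x => Phi_ (x + l)).
  apply: ray_ac_derive => [x cx|].
    have d1 : is_derive (x + l) 1 Psi (Phi_ (x + l)) by apply: dPsi; rewrite (le_lt_trans cx)// ltrDl.
    have d2 : is_derive x 1 (fun x => x + l) 1 by exact: is_derive_shift.
    by have := @is_derive1_comp R Psi (fun x => x + l) x _ _ d1 d2; rewrite mulr1.
  move=> x; apply: (@continuous_comp _ _ _ (fun x => Num.max c x + l) Phi_); last exact: cPhi.
  by apply: cvgD; [apply: continuous_max => //; exact: cst_continuous | exact: cvg_cst].
have acH := ray_acB (ray_acZ l^-1 (ray_acB acPsil acPsi)) acPhi.
exists (fun x => l^-1 * (Psi (x + l) - Psi x) - Phi x); split.
  apply: ray_ac_eq acH => // x cx; congr (_ - _).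
  have xl : x <= x + l by rewrite lerDl ltW.
  have cxl : c <= x + l := le_trans cx xl.
  by rewrite /average -(ray_acE acPhi cx xl) /Phi_ (max_r cx) (max_r cxl).
have acM := ray_acZ M (ray_ac_id c).
move=> x cx; have xl : x <= x + l by rewrite lerDl ltW.
have M0 : 0 <= M by apply: le_trans (FM cx).
have cxl : c <= x + l := le_trans cx xl.
rewrite -(ler_pM2l l_gt0) -{1}(gtr0_norm l_gt0) -normrM mulrBr mulrA divff ?gt_eqF// mul1r.
have := ray_ac_dist (ray_acB acPsi (ray_acZ (Phi x) (ray_ac_id c)))
  (ray_acZ (M * l) (ray_ac_id c)) cx cxl.
rewrite min_l// max_r// /id => /(_ _)/le_trans.
have -> : Psi (x + l) - Phi x * (x + l) - (Psi x - Phi x * x) =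
  Psi (x + l) - Psi x - l * Phi x by ring.
apply; last first.
  by rewrite -mulrBr addrC addKr mulrC ger0_norm// !mulr_ge0// ltW.
move=> t /andP[xt tl]; rewrite mulr1 /Phi_ max_r; last lra.
have ct : c <= t by lra.
apply: (le_trans (ray_ac_dist acPhi acM cx ct _)).
  move=> s; rewrite min_l// max_r// => /andP[xs _]; rewrite mulr1.
  by apply: FM; lra.
rewrite /id -mulrBr ger0_norm; last by rewrite mulr_ge0// subr_ge0.
rewrite mulr1 ler_wpM2l//.
by rewrite lerBlDl.
Qed.

End MovingAverage.

(** * The perturbed Riccati equation *)

Section PerturbedRiccati.
Context {R : realType}.
Variables (c eps d : R) (L v0 La Q p q F H avg : R -> R).
Hypotheses
  (L_gt0 : forall t, c <= t -> 0 < L t)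
  (acL : ray_ac c L (fun t => 2 * v0 t * L t + 1))
  (acv0 : ray_ac c v0 (fun t => Q t - v0 t ^+ 2))
  (acH : ray_ac c H (fun t => avg t - F t))
  (p_gt0 : forall t, c <= t -> 0 < p t).

Let Dp t := 1 - (p t)^-1.
Let A t := L t * v0 t.

Hypotheses (eps_gt0 : 0 < eps) (d_ge0 : 0 <= d) (d_eps : 10 * d <= eps)
  (d12 : 12 * d <= 1).
Hypotheses
  (err1 : forall t, c <= t ->
     `|L t ^+ 2 * (q t - Q t) + Dp t * A t ^+ 2 - F t| <= d)
  (err2 : forall t, c <= t -> `|2 * Dp t * A t| <= d)
  (err3 : forall t, c <= t -> `|Dp t| <= d)
  (err4 : forall t, c <= t -> `|H t * (2 * A t + 1) / L t| <= d)
  (err5 : forall t, c <= t -> `|H t / L t| <= d).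

Let acLV : ray_ac c (fun t => (L t)^-1)
  (fun t => - (2 * v0 t * L t + 1) / L t ^+ 2).
Proof. by apply: ray_acV => // t /L_gt0; rewrite lt0r => /andP[]. Qed.

(** The subsolution is v = v0 + sigma / L with sigma = 1/2 - H / L.  Multiplied by
    L^2, the defect q - v' - v^2 / p becomes the average plus 1/4, up to the
    errors. *)
Lemma perturbed_subsolution : (forall t, c <= t -> - 4^-1 + eps <= avg t) ->
  exists v v' : R -> R, ray_ac c v v' /\
    forall t, c <= t -> v' t + (p t)^-1 * v t ^+ 2 <= q t.
Proof.
move=> avg_ge.
have acs := ray_acM (ray_acB (ray_ac_cst c 2^-1) (ray_acM acH acLV)) acLV.
have acv := ray_acD acv0 acs.
do 2 eexists; split; first exact: acv.
move=> t ct; rewrite /=.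
have Lt := L_gt0 ct; have pt := p_gt0 ct.
rewrite -subr_ge0 -(pmulr_rge0 _ (exprn_gt0 2 Lt)).
have pE : (p t)^-1 = 1 - Dp t by rewrite /Dp; ring.
move: (err1 ct) (err2 ct) (err3 ct) (err4 ct) (err5 ct) (avg_ge _ ct).
set e1 := _ - F t; set e2 := 2 * Dp t * A t; set e4 := _ / L t; set e5 := H t / L t.
move=> b1 b2 b3 b4 b5 ba.
set X := (X in 0 <= X).
have -> : X = avg t + 4^-1 - e5 ^+ 2 + e1 + e2 * (2^-1 - e5)
    + Dp t * (2^-1 - e5) ^+ 2 - e4.
  by rewrite /X pE /e1 /e2 /e4 /e5 /A; field; rewrite gt_eqF.
move: b1 b2 b3 b4 b5; rewrite !ler_norml.
clear X pE.
move: e1 e2 (Dp t) e4 e5 (avg t) ba => e1 e2 e3 e4 e5 av ba.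
move=> /andP[b1 b1'] /andP[b2 b2'] /andP[b3 b3'] /andP[b4 b4'] /andP[b5 b5'].
have := d_ge0; have := d_eps; have := d12 => d12' deps d0.
have d1 : d <= 12^-1 by lra.
have s0 : 0 <= 2^-1 - e5 <= 1 by apply/andP; split; lra.
have h5 : e5 ^+ 2 <= d by nra.
have h2 : - d <= e2 * (2^-1 - e5) by case/andP: s0 => s0 s1; nra.
have h3 : - d <= e3 * (2^-1 - e5) ^+ 2.
  have : 0 <= (2^-1 - e5) ^+ 2 <= 1.
    by rewrite sqr_ge0/= expr_le1//; case/andP: s0.
  by move: ((2^-1 - e5) ^+ 2) => s /andP[? ?]; nra.
lra.
Qed.

(** With sigma = L (w / u - v0), the function k = sigma + H / L - 1/2 blows up: the
    term - s^2 with s = sigma - 1/2 absorbs all errors that are at most quadratic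
    in sigma. *)
Lemma perturbed_oscillation (u w : R -> R) :
  ray_ac c La (fun t => (L t)^-1) -> La x @[x --> +oo] --> +oo ->
  ray_ac c u (fun t => (p t)^-1 * w t) -> ray_ac c w (fun t => q t * u t) ->
  (forall t, c <= t -> avg t <= - 4^-1 - eps) ->
  (forall t, c <= t -> u t != 0) -> False.
Proof.
move=> acLa Laoo acu acw avg_le u0.
have acy := ray_acM acw (ray_acV acu u0).
have acs := ray_acM acL (ray_acB acy acv0).
have ack := ray_acB (ray_acD acs (ray_acM acH acLV)) (ray_ac_cst c 2^-1).
apply: (@riccati_blow_up R c L La _ _ (eps / 2) 4^-1 _ _ L_gt0 acLa Laoo ack).
- by rewrite divr_gt0.
- by rewrite invr_gt0.
move=> t ct; rewrite /=.
have Lt := L_gt0 ct; have pt := p_gt0 ct; have ut := u0 _ ct.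
rewrite -[leRHS]mulNr ler_pdivlMr//.
have pE : (p t)^-1 = 1 - Dp t by rewrite /Dp; ring.
move: (err1 ct) (err2 ct) (err3 ct) (err4 ct) (err5 ct) (avg_le _ ct).
set e1 := _ - F t; set e2 := 2 * Dp t * A t; set e4 := _ / L t; set e5 := H t / L t.
move=> b1 b2 b3 b4 b5 ba.
pose s := L t * (w t / u t - v0 t) - 2^-1.
set X := (X in X <= _); set k := (X in X ^+ 2).
have -> : k = s + e5 by rewrite /k /s /e5; ring.
have -> : X = avg t + 4^-1 - s ^+ 2 + e1 + e2 * (s + 2^-1)
    + Dp t * (s + 2^-1) ^+ 2 - e4.
  by rewrite /X pE /e1 /e2 /e4 /s /A; field; rewrite ut gt_eqF.
move: b1 b2 b3 b4 b5; rewrite !ler_norml.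
clear X k pE.
move: s e1 e2 (Dp t) e4 e5 (avg t) ba => s e1 e2 e3 e4 e5 av ba.
move=> /andP[b1 b1'] /andP[b2 b2'] /andP[b3 b3'] /andP[b4 b4'] /andP[b5 b5'].
have := eps_gt0; have := d_ge0; have := d_eps; have := d12 => d12' deps d0 eps0.
have h5 : (s + e5) ^+ 2 <= 2 * s ^+ 2 + 2 * d.
  have : e5 ^+ 2 <= d by nra.
  by have := sqr_ge0 (s - e5); nra.
have s2 := sqr_ge0 s.
have h2 : e2 * (s + 2^-1) <= d * (s ^+ 2 + 1).
  have := sqr_ge0 (s - 2^-1); have := sqr_ge0 (s + 2^-1) => q1 q2.
  by have [h|h] := leP 0 (s + 2^-1); nra.
have h3 : e3 * (s + 2^-1) ^+ 2 <= d * (2 * s ^+ 2 + 2^-1).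
  have h := sqr_ge0 (s + 2^-1); have := sqr_ge0 (s - 2^-1) => q2.
  apply: (@le_trans _ _ (d * (s + 2^-1) ^+ 2)); first by rewrite ler_wpM2r.
  by rewrite ler_wpM2l//; nra.
have h1 : d * s ^+ 2 <= 12^-1 * s ^+ 2 by rewrite ler_wpM2r//; lra.
nra.
Qed.

End PerturbedRiccati.

(** * Iterated logarithms *)

Section IteratedLogarithms.
Context {R : realType}.
Implicit Types (c t : R) (n : nat).

Lemma cvg_lny : ln x @[x --> +oo] --> (+oo : set_system R).
Proof.
apply/cvgryPge => A; exists (expR A); split; first exact: num_real.
move=> x xA; have x0 : 0 < x := lt_trans (expR_gt0 A) xA.
by rewrite -[leLHS]expRK ler_ln ?posrE ?expR_gt0// ltW.
Qed.

Lemma cvg_iter_log n : iter_log n x @[x --> +oo] --> (+oo : set_system R).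
Proof.
elim: n => [|n IH]; first exact: cvg_id.
apply: (cvg_comp (iter_log n) (fun x => ln `|x|) IH).
apply: cvg_trans cvg_lny; apply: near_eq_cvg; near=> x.
by rewrite gtr0_norm//; near: x; exact: nbhs_pinfty_gt.
Unshelve. all: by end_near. Qed.

(** Where all logarithms are positive, the absolute values in their definition
    disappear. *)
Definition logs_positive n c :=
  forall j, (j <= n)%N -> forall t, c <= t -> 0 < iter_log j t.

Lemma logs_positive_near n : exists c0, forall c, c0 <= c -> logs_positive n c.
Proof.
elim: n => [|n [c0 IH]].
  exists 1 => c c1 [|//] _ t ct; rewrite /=; lra.
have /cvgryPgt/(_ 0)[M [_ MP]] := cvg_iter_log n.+1.
exists (Num.max c0 (M + 1)) => c; rewrite ge_max => /andP[c0c Mc] j.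
rewrite leq_eqVlt => /predU1P[-> t ct|]; last exact: IH.
by apply: MP; lra.
Qed.

Lemma iter_L_gt0 n c t : logs_positive n c -> c <= t -> 0 < iter_L n t.
Proof.
move=> lp ct; rewrite /iter_L big_mkord prodr_gt0// => i _.
by apply: lp ct; rewrite -ltnS.
Qed.

Lemma iter_L0 t : iter_L 0 t = t. Proof. by rewrite /iter_L big_nat1. Qed.

Lemma iter_LS n t : iter_L n.+1 t = iter_L n t * iter_log n.+1 t.
Proof. by rewrite /iter_L big_nat_recr. Qed.

Lemma logs_positive_leq m n c : (m <= n)%N -> logs_positive n c -> logs_positive m c.
Proof. by move=> mn lp j jm; apply: lp; exact: leq_trans mn. Qed.

Lemma ray_ac_ln c (f f' : R -> R) : ray_ac c f f' -> (forall t, c <= t -> 0 < f t) ->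
  ray_ac c (fun t => ln `|f t|) (fun t => (f t)^-1 * f' t).
Proof.
move=> ff' f0; have cf := ray_ac_continuous ff'.
apply: ray_ac_eq (ray_ac_comp (phi := @ln R) (phi' := fun x => x^-1) ff' _ _) => //.
- by move=> t ct; rewrite /= gtr0_norm// f0.
- by move=> t ct; apply: is_derive1_ln; exact: f0.
- by move=> t; apply: cvgV; [rewrite gt_eqF// f0// le_max lexx | exact: cf].
Qed.

Lemma ray_ac_iter_log n c : logs_positive n c ->
  ray_ac c (iter_log n.+1) (fun t => (iter_L n t)^-1).
Proof.
elim: n => [|n IH] lp.
  apply: ray_ac_eq (ray_ac_ln (ray_ac_id c) (lp 0%N isT)) => t _ //.
  by rewrite mulr1 iter_L0.
apply: ray_ac_eq (ray_ac_ln (IH (logs_positive_leq (leqnSn n) lp)) (lp n.+1 (leqnn _))) => t _ //.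
by rewrite iter_LS invfM mulrC.
Qed.

(** This sum is L_{n-1}' / (2 L_{n-1}), the logarithmic derivative of the solution
    sqrt(L_{n-1}) of - u'' + Q_n u = 0, where L_{-1} = 1. *)
Definition half_log_derivative n t : R :=
  2^-1 * \sum_(0 <= j < n) (iter_L j t)^-1.

Lemma half_log_derivativeS n t :
  half_log_derivative n.+1 t = half_log_derivative n t + 2^-1 * (iter_L n t)^-1.
Proof. by rewrite /half_log_derivative big_nat_recr//= mulrDr. Qed.

Lemma half_log_derivative0 t : half_log_derivative 0 t = 0.
Proof. by rewrite /half_log_derivative big_nil mulr0. Qed.

Lemma iter_QS n t : iter_Q n.+1 t = iter_Q n t - 4^-1 * (iter_L n t ^+ 2)^-1.
Proof. by rewrite /iter_Q big_nat_recr//= mulrDr !mulNr. Qed.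

Lemma ray_ac_iter_L n c : logs_positive n c ->
  ray_ac c (iter_L n) (fun t => 2 * half_log_derivative n t * iter_L n t + 1).
Proof.
elim: n => [|n IH] lp.
  apply: ray_ac_eq (ray_ac_id c) => t _; first by rewrite iter_L0.
  by rewrite half_log_derivative0 mulr0 mul0r add0r.
have lpn := logs_positive_leq (leqnSn n) lp.
apply: ray_ac_eq (ray_acM (IH lpn) (ray_ac_iter_log lpn)) => t ct.
  by rewrite iter_LS.
have L0 := iter_L_gt0 lpn ct.
by rewrite half_log_derivativeS iter_LS; field; rewrite gt_eqF.
Qed.

(** This is the Riccati equation v' + v^2 = Q_n of the unperturbed problem. *)
Lemma ray_ac_half_log_derivative n c : logs_positive n c ->
  ray_ac c (half_log_derivative n)
    (fun t => iter_Q n t - half_log_derivative n t ^+ 2).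
Proof.
elim: n => [|n IH] lp.
  apply: ray_ac_eq (ray_ac_cst c 0) => t _; rewrite half_log_derivative0//.
  by rewrite /iter_Q big_nil mulr0 expr0n/= subr0.
have lpn := logs_positive_leq (leqnSn n) lp.
have acLV := ray_acV (ray_ac_iter_L lpn) _.
apply: ray_ac_eq (ray_acD (IH lpn) (ray_acZ 2^-1 (acLV _))) => [t _|t ct|t ct].
- by rewrite half_log_derivativeS.
- have L0 := iter_L_gt0 lpn ct.
  by rewrite half_log_derivativeS iter_QS; field; rewrite gt_eqF.
- by rewrite gt_eqF// (iter_L_gt0 lpn ct).
Qed.

Lemma cvg_invy (f : R -> R) : f x @[x --> +oo] --> +oo ->
  (f x)^-1 @[x --> +oo] --> (0 : R).
Proof.
by move=> foo; apply/gtr0_cvgV0 => //; move/cvgryPgt : foo; apply.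
Qed.

Lemma cvg_inv_iter_L n : (iter_L n x)^-1 @[x --> +oo] --> (0 : R).
Proof.
elim: n => [|n IH]; first by under eq_fun do rewrite iter_L0; exact: cvg_invy cvg_id.
under eq_fun do rewrite iter_LS invfM.
by have := cvgM IH (cvg_invy (cvg_iter_log n.+1)); rewrite mulr0; exact.
Qed.

Lemma cvg_half_log_derivative n : half_log_derivative n x @[x --> +oo] --> (0 : R).
Proof.
elim: n => [|n IH].
  by under eq_fun do rewrite half_log_derivative0; exact: cvg_cst.
under eq_fun do rewrite half_log_derivativeS.
have := cvgD IH (cvgM (cvg_cst (2^-1 : R)) (cvg_inv_iter_L n)).
by rewrite mulr0 addr0; exact.
Qed.

Lemma cvg_id_div_iter_L n : x / iter_L n x @[x --> +oo] --> (1 - delta n : R).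
Proof.
case: n => [|n].
  rewrite /= subr0; apply: cvg_near_cst; near=> x; rewrite iter_L0 divff//.
  by rewrite gt_eqF//; near: x; exact: nbhs_pinfty_gt.
rewrite /= subrr; elim: n => [|n IH].
  apply: cvg_trans (cvg_invy (cvg_iter_log 1)); apply: near_eq_cvg; near=> x.
  rewrite iter_LS iter_L0 invfM mulrA divff ?mul1r//.
  by rewrite gt_eqF//; near: x; exact: nbhs_pinfty_gt.
under eq_fun do rewrite iter_LS invfM mulrA.
by have := cvgM IH (cvg_invy (cvg_iter_log n.+2)); rewrite mulr0; exact.
Unshelve. all: by end_near. Qed.

Lemma cvg_id_half_log_derivative n :
  x * half_log_derivative n x @[x --> +oo] --> (delta n / 2 : R).
Proof.
case: n => [|n].
  rewrite /= mul0r; under eq_fun do rewrite half_log_derivative0 mulr0.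
  exact: cvg_cst.
rewrite /= mul1r; elim: n => [|n IH].
  apply: cvg_near_cst; near=> x.
  rewrite half_log_derivativeS half_log_derivative0 iter_L0 add0r mulrCA divff ?mulr1//.
  by rewrite gt_eqF//; near: x; exact: nbhs_pinfty_gt.
under eq_fun => x do rewrite half_log_derivativeS mulrDr [X in _ + X]mulrCA.
have h : 2^-1 * (x / iter_L n.+1 x) @[x --> +oo] --> (2^-1 * (1 - delta n.+1) : R).
  by apply: cvgM; [exact: cvg_cst | exact: cvg_id_div_iter_L].
by have := cvgD IH h; rewrite /= subrr mulr0 addr0; exact.
Unshelve. all: by end_near. Qed.

End IteratedLogarithms.

(** * Local integrability on a half-line *)

Section LocalIntegrability.
Context {R : realType}.
Implicit Types (a b c x y : R) (f g h : R -> R).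
Local Notation mu := (@lebesgue_measure R).

Lemma locally_integrable_ray a c f : locally_integrable `]a, +oo[ f -> a < c ->
  ray_integrable c f.
Proof.
move=> [mf _ Kf] ac x cx.
have cxa : `[c, x] `<=` `]a, +oo[.
  by move=> t /=; rewrite !in_itv/= andbT => /andP[ct _]; exact: lt_le_trans ct.
apply/integrableP; split.
  by apply/measurable_EFinP; apply: measurable_funS mf.
apply: Kf => //; exact: segment_compact.
Qed.

(** At a regular endpoint, local integrability on the open half-line improves to
    integrability up to the endpoint. *)
Lemma locally_integrable_ray_left a c f : locally_integrable `]a, +oo[ f -> a < c ->
  mu.-integrable `]a, c] (EFin \o f) -> ray_integrable a f.
Proof.
move=> lf ac iac x ax; have [mf _ Kf] := lf.
have mac y : measurable_fun `[a, y] f.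
  apply/measurable_fun_itv_obnd_cbndP; apply: measurable_funS mf => //.
  by apply: subset_itvl; rewrite bnd_simp.
apply: (@integrableS _ _ _ mu `[a, Num.max c x]%classic) => //.
  by apply: subset_itvl; rewrite bnd_simp le_max lexx orbT.
apply/integrableP; split; first by apply/measurable_EFinP; exact: mac.
have cmax : c <= Num.max c x by rewrite le_max lexx.
have mnf D : measurable_fun D f -> measurable_fun D (fun t => `|(f t)%:E|%E).
  by move=> mD; apply: measurableT_comp => //; exact/measurable_EFinP.
have mo u v : a <= u -> measurable_fun `]u, v] (fun t => `|(f t)%:E|%E).
  move=> au; apply: mnf; apply: measurable_funS mf => //.
  by apply: subset_itv; rewrite bnd_simp.
rewrite [ltLHS](_ : _ = (\int[mu]_(t in `]a, Num.max c x]) `|(f t)%:E|)%E); last first.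
  by rewrite -integral_itv_obnd_cbnd//; exact: mo.
have a_c : (BRight a <= BRight c)%O by rewrite bnd_simp ltW.
have c_max : (BRight c <= BRight (Num.max c x))%O by rewrite bnd_simp.
rewrite (itv_bndbnd_setU a_c c_max).
have mU : measurable_fun (`]a, c] `|` `]c, Num.max c x]) (fun t => `|(f t)%:E|%E).
  by apply/measurable_funU => //; split; apply: mo => //; exact: ltW.
rewrite ge0_integral_setU//=; last first.
  apply/disj_setPS => t [/=]; rewrite !in_itv/= => /andP[_ tc] /andP[ct _].
  by move: tc; rewrite leNgt ct.
rewrite lte_add_pinfty//; first by case/integrableP : iac.
have := locally_integrable_ray lf ac cmax => /integrableP[_].
apply: le_lt_trans; apply: ge0_subset_integral => //.
  apply: mnf; apply: measurable_funS mf => //.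
  by apply: subset_itv; rewrite bnd_simp.
by apply: subset_itv; rewrite bnd_simp.
Qed.

Lemma ray_integrable_locally a f : ray_integrable a f ->
  locally_integrable `]a, +oo[ f.
Proof.
move=> iF; have mf : measurable_fun `]a, +oo[ f.
  rewrite itv_bndy_bigcup_BRight; apply/measurable_fun_bigcup => // k.
  have ak : a <= a + k%:R by rewrite lerDl.
  have /measurable_EFinP := measurable_int mu (iF _ ak).
  by apply: measurable_funS => //; apply: subset_itvr; rewrite bnd_simp.
split=> // K Ka cK.
have [M [_ MK]] := compact_bounded cK.
pose b := Num.max a (`|M| + 1).
have ab : a <= b by rewrite le_max lexx.
have Kab : K `<=` `[a, b].
  move=> t Kt; have := Ka t Kt; rewrite /= !in_itv/= andbT => /ltW -> /=.
  rewrite (le_trans (ler_norm t))// (le_trans (MK (`|M| + 1) _ t Kt))//.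
    by rewrite (le_lt_trans (ler_norm _))// ltrDl.
  by rewrite le_max lexx orbT.
have /integrableP[_] := iF b ab; apply: le_lt_trans.
apply: ge0_subset_integral => //; first exact: compact_measurable.
have /measurable_EFinP mfb := measurable_int mu (iF b ab).
by do 2 apply: measurableT_comp => //.
Qed.

Lemma ray_ac_with_derivative a f g : ray_ac a f g -> ac_with_derivative a f g.
Proof.
move=> fg; split; first exact: ray_integrable_locally fg.1.
by move=> x y ax xy; exact: ray_acE fg (ltW ax) xy.
Qed.

Lemma ac_with_derivative_ray a c f g : ac_with_derivative a f g -> a < c ->
  ray_ac c f g.
Proof.
move=> [lg fE] ac; split; first exact: locally_integrable_ray lg ac.
by move=> x cx; rewrite -(fE c x ac cx) addrC subrK.
Qed.

(** Equations that hold almost everywhere turn into equations for the chosen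
    derivative. *)
Lemma ray_ac_ae c f g h : ray_ac c f g -> ray_integrable c h ->
  {ae mu, forall x, c <= x -> g x = h x} -> ray_ac c f h.
Proof.
move=> fg ih gh; split=> // x cx; rewrite fg.2//; congr (_ + fine _).
apply: ae_eq_integral => //.
- exact: measurable_int (fg.1 x cx).
- exact: measurable_int (ih x cx).
case: gh => N [mN N0 subN]; exists N; split=> // t /= nt; apply: subN => /= ght.
by apply: nt; rewrite in_itv/= => /andP[ct _]; rewrite ght.
Qed.

End LocalIntegrability.

(** * Asymptotics at infinity *)

Section MovingAverageLimits.
Context {R : realType}.
Implicit Types (f : R -> R).

Lemma near_pinfty_ray (P : R -> Prop) : (\forall x \near +oo, P x) ->
  exists c, forall x, c <= x -> P x.
Proof. by move=> [M [_ MP]]; exists (M + 1) => x Mx; apply: MP; lra. Qed.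

Lemma ereal_lt_gap (s : \bar R) (r : R) : (s < r%:E)%E ->
  exists2 eps, 0 < eps & (s <= (r - eps)%:E)%E.
Proof.
case: s => [s| |] //; rewrite ?lte_fin => sr.
  by exists (r - s); rewrite ?subr_gt0// lee_fin; lra.
by exists 1 => //; exact: leNye.
Qed.

Lemma inf_limsup_average_lt f (r : R) : (inf_limsup_average f < r%:E)%E ->
  exists l eps c, [/\ 0 < l, 0 < eps & forall x, c <= x -> average f l x <= r - eps].
Proof.
move=> /ereal_inf_lt[_ [l /= l0 <-]] /ereal_inf_lt[_ [V Voo <-]] /ereal_lt_gap[eps eps0 Vr].
have [c cV] := near_pinfty_ray Voo.
exists l, eps, c; split=> // x cx; rewrite -lee_fin; apply: le_trans Vr.
by apply: ereal_sup_ubound; exists x => //; exact: cV.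
Qed.

Lemma sup_liminf_average_gt f (r : R) : (r%:E < sup_liminf_average f)%E ->
  exists l eps c, [/\ 0 < l, 0 < eps & forall x, c <= x -> r + eps <= average f l x].
Proof.
move=> /ereal_sup_gt[_ [l /= l0 <-]]; rewrite limf_einfE.
move=> /ereal_sup_gt[_ [V Voo <-]] rV.
have [eps eps0 Vr] : exists2 eps, 0 < eps & ((r + eps)%:E <= ereal_inf [set (average f l x)%:E | x in V])%E.
  move: rV; rewrite -lteN2 => /ereal_lt_gap[eps eps0 h]; exists eps => //.
  by rewrite -leeN2; move: h; rewrite -opprD.
have [c cV] := near_pinfty_ray Voo.
exists l, eps, c; split=> // x cx; rewrite -lee_fin; apply: le_trans Vr _.
by apply: ereal_inf_lbound; exists x => //; exact: cV.
Qed.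

End MovingAverageLimits.

Section Asymptotics.
Context {R : realType}.

Lemma bounded_cvg0 (f g : R -> R) C : (\forall x \near +oo, `|f x| <= C) ->
  g x @[x --> +oo] --> 0 -> f x * g x @[x --> +oo] --> (0 : R).
Proof.
move=> fC g0; apply/cvgrPdist_le => e e0.
have eC : 0 < e / (`|C| + 1) by rewrite divr_gt0// ltr_wpDl.
have /cvgrPdist_le/(_ _ eC) gs := g0.
near=> x; rewrite sub0r normrN normrM.
have fx : `|f x| <= `|C| + 1.
  rewrite (@le_trans _ _ C)//; first by near: x.
  by rewrite (le_trans (ler_norm _))// lerDl.
have gx : `|g x| <= e / (`|C| + 1).
  by rewrite -normrN -sub0r; near: x.
apply: (le_trans (ler_pM _ _ fx gx)) => //.
by rewrite mulrC divfK// gt_eqF// ltr_wpDl.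
Unshelve. all: by end_near. Qed.

Lemma near_pinfty_gt (M : R) : \forall x \near +oo, M < x.
Proof. by apply: nbhs_pinfty_gt; exact: num_real. Qed.

Lemma iter_L_near_gt0 n : \forall x \near (+oo : set_system R), 0 < iter_L n x.
Proof.
have [c cP] := @logs_positive_near R n.
near=> x; apply: (iter_L_gt0 (cP c (lexx c))); apply: ltW.
by near: x; exact: near_pinfty_gt.
Unshelve. all: by end_near. Qed.

Lemma potential_bounded n (q q0 : R -> R) :
  q = q0 +O_ +oo (fun x => (iter_L n x ^+ 2)^-1) ->
  exists C, \forall x \near +oo, `|iter_L n x ^+ 2 * (q x - q0 x)| <= C.
Proof.
move=> /eqaddOP/bigO_exP[C _ qC]; exists C; near=> x.
have Lx : 0 < iter_L n x by near: x; exact: iter_L_near_gt0.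
have L2 : 0 < iter_L n x ^+ 2 by rewrite exprn_gt0.
rewrite normrM (gtr0_norm L2) -ler_pdivlMl// mulrC.
have : `|(q - q0) x| <= C * `|(iter_L n x ^+ 2)^-1| by near: x.
by rewrite (gtr0_norm (_ : 0 < (iter_L n x ^+ 2)^-1)) ?invr_gt0.
Unshelve. all: by end_near. Qed.

Lemma inv_near1 (p k : R) : 0 < p -> `|p - 1| <= k -> k <= 2^-1 ->
  `|1 - p^-1| <= 2 * k.
Proof.
move=> p0 pk k2; have p2 : 2^-1 <= p by move: pk; rewrite ler_norml => /andP[]; lra.
have -> : 1 - p^-1 = (p - 1) / p by field; rewrite gt_eqF.
rewrite normrM (gtr0_norm (_ : 0 < p^-1)) ?invr_gt0// ler_pdivrMr//.
have : 0 <= k := le_trans (normr_ge0 _) pk.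
by move: pk; nra.
Qed.

(** Both cases of the asymptotics of p give the same two facts, which are all that
    is needed below: for n = 0 the factor L^2 / x^2 is 1, and for n >= 1 its inverse
    tends to 0. *)
Lemma leading_coefficient_perturbation n (p : R -> R) :
  (if n is 0%N then p = (fun=> 1) +o_ +oo (fun=> 1 : R)
   else p = (fun=> 1) +O_ +oo (fun x => x ^+ 2 / iter_L n x ^+ 2)) ->
  (\forall x \near +oo, 0 < p x) ->
  (exists C, \forall x \near +oo, `|iter_L n x ^+ 2 / x ^+ 2 * (1 - (p x)^-1)| <= C) /\
  1 - (p x)^-1 @[x --> +oo] --> (0 : R).
Proof.
case: n => [|n].
  move=> /eqaddoP po p0.
  have Dp e : 0 < e -> \forall x \near +oo, `|1 - (p x)^-1| <= e.
    move=> e0; pose k := Num.min (e / 2) 2^-1.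
    have k0 : 0 < k by rewrite lt_min divr_gt0//= invr_gt0.
    have pk := po k k0.
    near=> x; rewrite (@le_trans _ _ (2 * k))//; last first.
      have : k <= e / 2 by rewrite ge_min lexx.
      lra.
    apply: inv_near1; first by near: x.
      have : `|(p - cst 1) x| <= k * `|1| by near: x.
      by rewrite normr1 mulr1.
    by rewrite ge_min lexx orbT.
  split.
    exists 1; near=> x.
    have x0 : 0 < x by near: x; exact: near_pinfty_gt.
    rewrite iter_L0 divff ?mul1r ?expf_neq0 ?gt_eqF//.
    by near: x; exact: Dp.
  apply/cvgrPdist_le => e e0; have := Dp e e0.
  by apply: filterS => x; rewrite sub0r normrN.
move=> /eqaddOP/bigO_exP[C /= C0 pC] p0.
have xL0 : x / iter_L n.+1 x @[x --> +oo] --> (0 : R).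
  by have := @cvg_id_div_iter_L R n.+1; rewrite /= subrr.
have e0 : x ^+ 2 / iter_L n.+1 x ^+ 2 @[x --> +oo] --> (0 : R).
  under eq_fun do rewrite -expr_div_n expr2.
  by have := cvgM xL0 xL0; rewrite mulr0; exact.
have DpC : \forall x \near +oo,
    `|1 - (p x)^-1| <= 2 * (C * (x ^+ 2 / iter_L n.+1 x ^+ 2)).
  have C2 : 0 < 2^-1 / C by rewrite divr_gt0.
  have /cvgrPdist_le/(_ _ C2) e2 := e0.
  near=> x.
  have Lx : 0 < iter_L n.+1 x by near: x; exact: iter_L_near_gt0.
  have ex : 0 <= x ^+ 2 / iter_L n.+1 x ^+ 2 by rewrite divr_ge0 ?sqr_ge0.
  apply: inv_near1; first by near: x.
    have : `|(p - cst 1) x| <= C * `|x ^+ 2 / iter_L n.+1 x ^+ 2| by near: x.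
    by rewrite (ger0_norm ex).
  rewrite -ler_pdivlMl// [leRHS]mulrC -(ger0_norm ex) -normrN -sub0r.
  by near: x.
have bdd : \forall x \near +oo,
    `|iter_L n.+1 x ^+ 2 / x ^+ 2 * (1 - (p x)^-1)| <= 2 * C.
  near=> x.
  have Lx : 0 < iter_L n.+1 x by near: x; exact: iter_L_near_gt0.
  have x0 : 0 < x by near: x; exact: near_pinfty_gt.
  have r0 : 0 < iter_L n.+1 x ^+ 2 / x ^+ 2 by rewrite divr_gt0 ?exprn_gt0.
  rewrite normrM (gtr0_norm r0) -ler_pdivlMl//.
  rewrite (@le_trans _ _ (2 * (C * (x ^+ 2 / iter_L n.+1 x ^+ 2))))//.
    by near: x.
  by rewrite mulrA invf_div mulrC.
split; first by exists (2 * C).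
apply: cvg_trans (bounded_cvg0 bdd e0); apply: near_eq_cvg; near=> x.
have Lx : 0 < iter_L n.+1 x by near: x; exact: iter_L_near_gt0.
have x0 : 0 < x by near: x; exact: near_pinfty_gt.
by field; rewrite !gt_eqF//; near: x.
Unshelve. all: by end_near. Qed.

End Asymptotics.

(** * The errors of the perturbed Riccati equation are small *)

Section AveragedRiccati.
Context {R : realType}.
Local Notation mu := (@lebesgue_measure R).

Variables (n : nat) (p0 q0 p1 q1 : R -> R).
Let a : R := iter_e n.
Let L : R -> R := iter_L n.
Let v0 : R -> R := half_log_derivative n.
Let Dp t := 1 - (p1 t)^-1.
Let F t := L t ^+ 2 * (Delta_q q0 q1 t + delta n / (4 * t ^+ 2) * Delta_p p0 p1 t).
Hypotheses (ip1 : locally_integrable `]a, +oo[ (fun x => (p1 x)^-1))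
  (iq0 : locally_integrable `]a, +oo[ q0) (iq1 : locally_integrable `]a, +oo[ q1)
  (p1_gt0 : forall x, a < x -> 0 < p1 x)
  (p0E : forall x, a < x -> p0 x = 1)
  (q0E : forall x, a < x -> q0 x = iter_Q n x)
  (q1_asymp : q1 = iter_Q n +O_ +oo (fun x => (iter_L n x ^+ 2)^-1))
  (p1_asymp : if n is 0%N
     then p1 = (fun=> 1) +o_ +oo (fun=> 1 : R)
     else p1 = (fun=> 1) +O_ +oo (fun x => x ^+ 2 / iter_L n x ^+ 2)).

Lemma rescaled_perturbationE t : a < t ->
  F t = L t ^+ 2 * (q1 t - iter_Q n t) + delta n / (4 * t ^+ 2) * L t ^+ 2 * Dp t.
Proof.
move=> at_; rewrite /F /Delta_q /Delta_p q0E// p0E// invr1 /Dp; ring.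
Qed.

Lemma ray_integrable_rescaled_perturbation c : a < c -> 0 < c -> logs_positive n c ->
  ray_integrable c F.
Proof.
move=> ac c0 lp; have acL := ray_ac_iter_L lp.
have cL2 := ray_ac_continuous (ray_acM acL acL).
have acid := ray_ac_id c.
have t0 t : c <= t -> t * t != 0 by move=> ct; rewrite mulf_neq0// gt_eqF//; lra.
have cV := ray_ac_continuous (ray_acV (ray_acM acid acid) t0).
have iq := ray_integrableD (locally_integrable_ray iq1 ac)
  (ray_integrableZ (-1) (locally_integrable_ray iq0 ac)).
have ip := ray_integrableD (ray_ac_id c).1
  (ray_integrableZ (-1) (locally_integrable_ray ip1 ac)).
have := ray_integrableD (ray_integrableM cL2 iq)
   (ray_integrableZ (delta n / 4) (ray_integrableM cL2 (ray_integrableM cV ip))).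
apply: ray_integrable_eq => t ct; have at_ : a < t by lra.
rewrite rescaled_perturbationE// q0E// /Dp /L.
by field; rewrite !gt_eqF ?p1_gt0//; lra.
Qed.

(** The first two errors are products of the bounded function L^2 Dp / x^2 with null
    functions; the cases n = 0 and n >= 1 are treated together through the limits
    delta_n / 2 of x v0 and 1 - delta_n of x / L.  The last two are products of the
    bounded function H with null functions. *)
Lemma averaged_riccati_data (l d c0 : R) : 0 < l -> 0 < d ->
  exists c H, [/\ a < c, c0 <= c, logs_positive n c,
    ray_ac c H (fun t => average F l t - F t) &
    forall t, c <= t ->
      [/\ `|L t ^+ 2 * (q1 t - iter_Q n t) + Dp t * (L t * v0 t) ^+ 2 - F t| <= d,
          `|2 * Dp t * (L t * v0 t)| <= d,
          `|Dp t| <= d,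
          `|H t * (2 * (L t * v0 t) + 1) / L t| <= d &
          `|H t / L t| <= d]].
Proof.
move=> l0 d0.
have p1pos : \forall x \near +oo, 0 < p1 x.
  by near=> x; apply: p1_gt0; near: x; exact: near_pinfty_gt.
have [C2 qC] := potential_bounded q1_asymp.
have [[C1 pC] Dp0] := leading_coefficient_perturbation p1_asymp p1pos.
have FM : \forall x \near +oo, `|F x| <= C2 + C1.
  near=> x.
  have ax : a < x by near: x; exact: near_pinfty_gt.
  have x0 : 0 < x by near: x; exact: near_pinfty_gt.
  rewrite rescaled_perturbationE// (le_trans (ler_normD _ _))// lerD//; first by near: x.
  have -> : delta n / (4 * x ^+ 2) * L x ^+ 2 * Dp x =
     delta n / 4 * (L x ^+ 2 / x ^+ 2 * Dp x) by field; rewrite gt_eqF.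
  have C1x : `|L x ^+ 2 / x ^+ 2 * Dp x| <= C1 by near: x.
  have d4 : `|delta n / 4| <= 1 :> R.
    by case: (n) => [|m] /=; rewrite ?mul0r ?normr0// ger0_norm; lra.
  rewrite normrM (le_trans _ C1x)// -[leRHS]mul1r ler_wpM2r//.
have [c1 c1P] := near_pinfty_ray FM.
have [c2 c2P] := @logs_positive_near R n.
pose c := Num.max (Num.max (a + 1) 1) (Num.max c0 (Num.max c1 c2)).
have ca : a + 1 <= c by rewrite !le_max lexx.
have c_1 : 1 <= c by rewrite !le_max lexx orbT.
have cc0 : c0 <= c by rewrite !le_max lexx !orbT.
have cc1 : c1 <= c by rewrite !le_max lexx !orbT.
have cc2 : c2 <= c by rewrite !le_max lexx !orbT.
have ac : a < c by lra.
have lp := c2P c cc2.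
have iF : ray_integrable c F by apply: ray_integrable_rescaled_perturbation => //; lra.
have [H [acH HM]] := moving_average_corrector l0 iF (fun t (ct : c <= t) => c1P t (le_trans cc1 ct)).
set K := (C2 + C1) * l in HM.
have K0 : 0 <= K := le_trans (normr_ge0 _) (HM c (lexx c)).
have g1 : (x * v0 x) ^+ 2 - delta n / 4 @[x --> +oo] --> (0 : R).
  have -> : 0 = (delta n / 2) * (delta n / 2) - delta n / 4 :> R.
    by case: (n) => [|m] /=; field.
  under eq_fun do rewrite expr2.
  apply: cvgB; last exact: cvg_cst.
  by apply: cvgM; exact: cvg_id_half_log_derivative.
have g2 : 2 * (x / L x * (x * v0 x)) @[x --> +oo] --> (0 : R).
  have -> : 0 = 2 * ((1 - delta n) * (delta n / 2)) :> R.
    by case: (n) => [|m] /=; field.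
  apply: cvgM; first exact: cvg_cst.
  apply: cvgM; [exact: cvg_id_div_iter_L | exact: cvg_id_half_log_derivative].
have g4 : 2 * v0 x + (L x)^-1 @[x --> +oo] --> (0 : R).
  have -> : 0 = 2 * 0 + 0 :> R by rewrite mulr0 addr0.
  apply: cvgD; last exact: cvg_inv_iter_L.
  by apply: cvgM; [exact: cvg_cst | exact: cvg_half_log_derivative].
have dK : 0 < d / (K + 1) by rewrite divr_gt0// ltr_wpDl.
have small (g : R -> R) (e : R) : g x @[x --> +oo] --> (0 : R) -> 0 < e -> \forall x \near +oo, `|g x| <= e.
  move=> g0 e0; move/cvgrPdist_le : g0 => /(_ e e0); apply: filterS => x.
  by rewrite sub0r normrN.
(* the common bounded factor of the first two errors *)
pose B x := iter_L n x ^+ 2 / x ^+ 2 * (1 - (p1 x)^-1).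
have E1 := small (fun x => B x * ((x * v0 x) ^+ 2 - delta n / 4)) d (bounded_cvg0 pC g1) d0.
have E2 := small (fun x => B x * (2 * (x / L x * (x * v0 x)))) d (bounded_cvg0 pC g2) d0.
have E3 := small Dp d Dp0 d0.
have E4 := small (fun x => 2 * v0 x + (L x)^-1) _ g4 dK.
have E5 := small (fun x => (L x)^-1) _ (@cvg_inv_iter_L R n) dK.
have [c3 c3P] := near_pinfty_ray (filterI E1 (filterI E2 (filterI E3 (filterI E4 E5)))).
exists (Num.max c c3), H.
have cm : c <= Num.max c c3 by rewrite le_max lexx.
split.
- by lra.
- exact: le_trans cm.
- by move=> j jn t ct; apply: lp jn _ _; exact: le_trans ct.
- exact: ray_ac_restrict acH cm.
move=> t; rewrite ge_max => /andP[ct /c3P[e1 [e2 [e3 [e4 e5]]]]].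
have at_ : a < t by lra.
have t0 : 0 < t by lra.
have Lt : 0 < L t := iter_L_gt0 lp ct.
have HKb (g : R) : `|g| <= d / (K + 1) -> `|H t * g| <= d.
  move=> gd; rewrite normrM (le_trans (ler_pM _ _ (HM t ct) gd))//.
  rewrite mulrCA ger_pMr// ler_pdivrMr ?ltr_wpDl// mul1r lerDl//.
split.
- rewrite rescaled_perturbationE//.
  rewrite [X in `|X|](_ : _ = iter_L n t ^+ 2 / t ^+ 2 * (1 - (p1 t)^-1) *
    ((t * v0 t) ^+ 2 - delta n / 4))//.
  by rewrite /Dp /L; field; rewrite !gt_eqF ?p1_gt0.
- rewrite [X in `|X|](_ : _ = iter_L n t ^+ 2 / t ^+ 2 * (1 - (p1 t)^-1) *
    (2 * (t / L t * (t * v0 t))))//.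
  by rewrite /Dp /L; field; rewrite !gt_eqF ?p1_gt0.
- exact: e3.
- rewrite -mulrA; apply: HKb.
  rewrite [X in `|X|](_ : _ = 2 * v0 t + (L t)^-1)//.
  by field; rewrite gt_eqF.
- by apply: HKb.
Unshelve. all: by end_near. Qed.

End AveragedRiccati.

(** * Oscillation and nonoscillation *)

Section RealSolutions.
Context {R : realType}.
Local Notation mu := (@lebesgue_measure R).
Variables (a : R) (p q r : R -> R).
Hypotheses (ip : locally_integrable `]a, +oo[ (fun x => (p x)^-1))
  (p_gt0 : forall x, a < x -> 0 < p x) (r_gt0 : forall x, a < x -> 0 < r x).

Lemma sl_solution_of_system (u w : R -> R) :
  ray_ac a u (fun x => (p x)^-1 * w x) -> ray_ac a w (fun x => q x * u x) ->
  sl_solution a p q r 0 (fun x => (u x)%:C%C).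
Proof.
move=> acu acw; have ac0 := ray_ac_with_derivative (ray_ac_cst a 0).
exists (fun x => ((p x)^-1 * w x)%:C%C), (fun x => (w x)%:C%C), (fun x => (q x * u x)%:C%C).
split; [by split=> //; exact: ray_ac_with_derivative|
        by split=> //; exact: ray_ac_with_derivative|].
apply: aeW => x ax; have p0 := p_gt0 ax.
rewrite -!rmorphM/= mulrA divff ?gt_eqF// mul1r; split=> //.
by rewrite addNr mulr0 mul0r subr0.
Qed.

(** The real parts of a solution and of its quasi-derivative are enough: the real
    system decouples from the imaginary one for the spectral parameter 0. *)
Lemma system_of_sl_solution (v : R -> R) c : a < c ->
  sl_solution a p q r 0 (fun x => (v x)%:C%C) -> locally_integrable `]a, +oo[ q ->
  exists w : R -> R, ray_ac c v (fun x => (p x)^-1 * w x) /\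
    ray_ac c w (fun x => q x * v x).
Proof.
move=> ac [du [w [dw [[acu _] [acw _] eqn]]]] iq.
have acu' := ac_with_derivative_ray acu ac.
have acw' := ac_with_derivative_ray acw ac.
have ip' := locally_integrable_ray ip ac.
have iq' := locally_integrable_ray iq ac.
have [N [mN N0 subN]] := eqn.
have ae_c (P : R -> Prop) : (forall x, a < x ->
    w x = (p x)%:C%C * du x /\
    ((r x)^-1)%:C%C * (- dw x + (q x)%:C%C * (v x)%:C%C) - 0 * (v x)%:C%C = 0 -> P x) ->
    {ae mu, forall x, c <= x -> P x}.
  move=> h; exists N; split=> // x /= nP; apply: subN => /= e; apply: nP => cx.
  have ax : a < x by lra.
  by apply: (h x ax); exact: e.
exists (fun x => complex.Re (w x)); split.
  apply: ray_ac_ae acu' _ _.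
    exact: ray_integrableMr (ray_ac_continuous acw') ip'.
  apply: ae_c => x ax [-> _]; have p0 := p_gt0 ax.
  case: (du x) => y z /=; rewrite mul0r subr0 mulrA mulVf ?mul1r// gt_eqF//.
apply: ray_ac_ae acw' _ _.
  exact: ray_integrableMr (ray_ac_continuous acu') iq'.
apply: ae_c => x ax [_]; have r0 := r_gt0 ax.
rewrite mul0r subr0 => /eqP; rewrite mulf_eq0 => /orP[|].
  by rewrite eq_complex/= invr_eq0 gt_eqF.
rewrite addrC subr_eq0 => /eqP <-.
by rewrite -rmorphM.
Qed.

End RealSolutions.

Lemma finite_set_bounded_above (R : realType) (A : set R) : finite_set A ->
  exists c, forall x, A x -> x < c.
Proof.
move=> /finite_compact/compact_bounded[M [_ MA]].
exists (`|M| + 2) => x Ax; rewrite (le_lt_trans (ler_norm x))//.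
rewrite (le_lt_trans (MA (`|M| + 1) _ x Ax))//; last lra.
by rewrite (le_lt_trans (ler_norm _))// ltrDl.
Qed.

Theorem corollary2p6 (R : realType) (n : nat) (p0 q0 p1 q1 r : R -> R)
  (coef0 : sl_coefficients (iter_e n) p0 q0 r)
  (coef1 : sl_coefficients (iter_e n) p1 q1 r)
  (regular0 : regular_left (iter_e n) p0 q0 r)
  (regular1 : regular_left (iter_e n) p1 q1 r)
  (limit_point0 : limit_point_pinfty (iter_e n) p0 q0 r)
  (limit_point1 : limit_point_pinfty (iter_e n) p1 q1 r)
  (p0E : forall x, iter_e n < x -> p0 x = 1)
  (q0E : forall x, iter_e n < x -> q0 x = iter_Q n x)
  (q1_asymp : q1 = iter_Q n +O_ +oo (fun x => (iter_L n x ^+ 2)^-1))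
  (p1_asymp : if n is 0%N
     then p1 = (fun=> 1) +o_ +oo (fun=> 1 : R)
     else p1 = (fun=> 1) +O_ +oo (fun x => x ^+ 2 / iter_L n x ^+ 2)) :
  let F := fun t => iter_L n t ^+ 2 *
             (Delta_q q0 q1 t + delta n / (4 * t ^+ 2) * Delta_p p0 p1 t) in
  ((inf_limsup_average F < (- 4^-1)%:E)%E ->
     oscillatory (iter_e n) p1 q1 r) /\
  ((sup_liminf_average F > (- 4^-1)%:E)%E ->
     nonoscillatory (iter_e n) p1 q1 r).
Proof.
move=> F; set a : R := iter_e n.
have [ip1 iq1 _ pr_gt0] := coef1; have [_ iq0 _ _] := coef0.
have p_gt0 x : a < x -> 0 < p1 x by case/pr_gt0.
have r_gt0 x : a < x -> 0 < r x by case/pr_gt0.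
have data l d c := @averaged_riccati_data R n p0 q0 p1 q1 ip1 iq0 iq1 p_gt0
  p0E q0E q1_asymp p1_asymp l d c.
(* the smallness that the quadratic estimates of the perturbed equation consume *)
have tolerance (eps : R) : 0 < eps ->
    exists d : R, [/\ 0 < d, 0 <= d, 10 * d <= eps & 12 * d <= 1].
  move=> eps0; exists (Num.min (eps / 10) 12^-1).
  have h1 : Num.min (eps / 10) 12^-1 <= eps / 10 by rewrite ge_min lexx.
  have h2 : Num.min (eps / 10) 12^-1 <= 12^-1 by rewrite ge_min lexx orbT.
  have h3 : 0 < Num.min (eps / 10) 12^-1 by rewrite lt_min divr_gt0//= invr_gt0.
  by split; lra.
split.
  move=> /inf_limsup_average_lt[l [eps [c0 [l0 eps0 avg]]]].
  move=> [v [solv _ /finite_set_bounded_above[c1 zeros]]].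
  have [d [d0 d0' d_eps d12]] := tolerance eps eps0.
  have [c [H [ac c0c lp acH errs]]] := data l d (Num.max c0 c1) l0 d0.
  move: c0c; rewrite ge_max => /andP[c0c c1c].
  have [w [acv acw]] := system_of_sl_solution ip1 p_gt0 r_gt0 ac solv iq1.
  apply: (@perturbed_oscillation R c eps d (iter_L n) (half_log_derivative n)
    (iter_log n.+1) (iter_Q n) p1 q1 F H (average F l)) acv acw _ _ => //.
  - by move=> t; exact: iter_L_gt0.
  - exact: ray_ac_iter_L.
  - exact: ray_ac_half_log_derivative.
  - by move=> t ct; apply: p_gt0; exact: lt_le_trans ct.
  - by move=> t /errs[].
  - by move=> t /errs[].
  - by move=> t /errs[].
  - by move=> t /errs[].
  - by move=> t /errs[].
  - exact: ray_ac_iter_log.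
  - exact: cvg_iter_log.
  - by move=> t ct; apply: avg; exact: le_trans ct.
  - move=> t ct; apply/negP => /eqP vt0.
    have : t < c1 by apply: zeros; split=> //; exact: lt_le_trans ct.
    lra.
move=> /sup_liminf_average_gt[l [eps [c0 [l0 eps0 avg]]]].
have [d [d0 d0' d_eps d12]] := tolerance eps eps0.
have [c [H [ac c0c lp acH errs]]] := data l d c0 l0 d0.
have [v [v' [acv ric]]] : exists v v' : R -> R, ray_ac c v v' /\
    forall t, c <= t -> v' t + (p1 t)^-1 * v t ^+ 2 <= q1 t.
  apply: (@perturbed_subsolution R c eps d (iter_L n) (half_log_derivative n)
    (iter_Q n) p1 q1 F H (average F l)) => //.
  - by move=> t; exact: iter_L_gt0.
  - exact: ray_ac_iter_L.
  - exact: ray_ac_half_log_derivative.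
  - by move=> t ct; apply: p_gt0; exact: lt_le_trans ct.
  - by move=> t /errs[].
  - by move=> t /errs[].
  - by move=> t /errs[].
  - by move=> t /errs[].
  - by move=> t /errs[].
  - by move=> t ct; apply: avg; exact: le_trans ct.
have [b ab [ipb iqb _]] := regular1.
have ip := locally_integrable_ray_left ip1 ab ipb.
have iq := locally_integrable_ray_left iq1 ab iqb.
have [u [w [acu acw ua wa]]] := linear_system_solution 1 0 ip iq.
have ua0 : u a != 0 by rewrite ua oner_neq0.
exists u; split.
- exact: (sl_solution_of_system r p_gt0 acu acw).
(* u (a) = 1, but nontriviality is about points beyond a *)
- have [e e0 eP] := (ray_continuousP _ _).1 (ray_ac_continuous acu) a (lexx a) 1 ltr01.
  exists (a + e / 2); first by rewrite ltrDl divr_gt0.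
  have ae : a <= a + e / 2 by rewrite lerDl divr_ge0// ltW.
  have e2 : `|a + e / 2 - a| < e by rewrite addrAC subrr add0r gtr0_norm; lra.
  apply/negP => /eqP u0; have := eP _ ae e2.
  by rewrite u0 ua sub0r normrN normr1 ltxx.
- apply: (@riccati_finite_zeros R a _ _ u w ip iq acu acw _ ua0 c v v' ac acv ric).
  by move=> t at_; rewrite invr_gt0 p_gt0.
Qed.
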